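(* Let $\theta=(\theta_1,\theta_2)$ be any pair of admissible premium strategies, i.e. deterministic, positive, uniformly bounded functions on $[0,T]$. Then the insurer's optimal reinsurance strategy $\bar p^\theta=(\bar p_1^\theta,\bar p_2^\theta)$ for the problem $\sup_{p\in\mathcal U_0}\mathbb E[U_0(X_0(T))\mid X_0(t)=x]$ is given, for $t\in[0,T]$, by \[ \bar p_1^\theta(t)=\frac{\delta_0\theta_2(t)}{\delta_0\theta_1(t)+\delta_0\theta_2(t)+2\theta_1(t)\theta_2(t)},\qquad \bar p_2^\theta(t)=\frac{\delta_0\theta_1(t)}{\delta_0\theta_1(t)+\delta_0\theta_2(t)+2\theta_1(t)\theta_2(t)}, \] and the insurer's value function is \[ \bar V_0^\theta(t,x)=-\frac{1}{\delta_0}\,e^{-\delta_0 x+f_0(t)},\qquad (t,x)\in[0,T]\times\mathbb R, \] where \[ f_0(t)=\delta_0\int_t^T\Big\{\mu-c+\frac{\delta_0\sigma^2\theta_1(s)\theta_2(s)}{\delta_0\theta_1(s)+\delta_0\theta_2(s)+2\theta_1(s)\theta_2(s)}\Big\}\,ds . \]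
   Context: Fix $T>0$ and a complete filtered probability space $(\Omega,\mathcal F,\mathbb F,\mathbb P)$ carrying a one-dimensional standard Brownian motion $W$, where $\mathbb F$ is the augmented natural filtration of $W$. Let $c>0$, $\mu>0$, $\sigma>0$ be constants; the insurer receives premium income at rate $c$ and faces aggregate loss $dL(t)=\mu\,dt+\sigma\,dW(t)$. The insurer buys proportional reinsurance from two reinsurers: an admissible reinsurance strategy is a pair $p=(p_1,p_2)$ of deterministic functions on $[0,T]$ with $p_i(t)\in[0,1]$ ($i=1,2$) and $p_1(t)+p_2(t)\in[0,1]$ for all $t$; their set is $\mathcal U_0$. Reinsurer $i$ uses the variance premium principle with loading $\theta_i(t)$, i.e. charges premium rate $c_i(t)=\mu p_i(t)+\theta_i(t)\sigma^2p_i(t)^2$. Hence the insurer's surplus satisfies \[ dX_0(t)=\big(c-\mu-\theta_1(t)\sigma^2p_1(t)^2-\theta_2(t)\sigma^2p_2(t)^2\big)dt-\sigma\big(1-p_1(t)-p_2(t)\big)dW(t). \] The insurer has exponential utility $U_0(x)=-\frac1{\delta_0}e^{-\delta_0x}$ with risk aversion $\delta_0>0$. For fixed $\theta$, the insurer's value function is $\bar V_0^\theta(t,x)=\sup_{p\in\mathcal U_0}\mathbb E[U_0(X_0(T))\mid X_0(t)=x]$, and an optimal strategy is a maximizer $\bar p^\theta\in\mathcal U_0$. *)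

(* Defs.v *)
From HB Require Import structures.
From mathcomp Require Import all_boot all_order all_algebra.
From mathcomp Require Import all_classical all_reals all_analysis.
Set Implicit Arguments. Unset Strict Implicit. Unset Printing Implicit Defensive.
Import Order.TTheory GRing.Theory Num.Theory.
Import numFieldNormedType.Exports.
Local Open Scope classical_set_scope.
Local Open Scope ring_scope.

Section Defs.
Context {R : realType} {d : measure_display} {Omega : measurableType d}.
Variable P : probability Omega R.

Definition increment (W : R -> Omega -> R) (s t : R) : Omega -> R :=
  fun w => W t w - W s w.

Definition is_brownian_motion (W : R -> Omega -> R) : Prop :=
  [/\ (forall w, W 0 w = 0),
      (forall t, measurable_fun setT (W t)),
      (forall w, {within `[0, +oo[, continuous (fun t => W t w)}),
      (forall s t, 0 <= s -> s < t -> forall A : set R, measurable A ->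
         P (increment W s t @^-1` A) = normal_prob 0 (Num.sqrt (t - s)) A) &
      (forall (n : nat) (tt : nat -> R) (A : nat -> set R),
         0 <= tt 0%N -> (forall i, (i < n)%N -> tt i < tt i.+1) ->
         (forall i, measurable (A i)) ->
         P (\bigcap_(i in [set i | (i < n)%N])
               (increment W (tt i) (tt i.+1) @^-1` A i))
         = (\prod_(i < n) P (increment W (tt i) (tt i.+1) @^-1` A i))%E)].

Definition step_fun (n : nat) (s c : nat -> R) (u : R) : R :=
  \sum_(i < n) c i * \1_(`[s i, s i.+1[) u.

Definition step_int (W : R -> Omega -> R) (n : nat) (s c : nat -> R)
  (w : Omega) : R :=
  \sum_(i < n) c i * (W (s i.+1) w - W (s i) w).

(** Y is (a version of) the Wiener integral  int_a^b g(u) dW(u)  of the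
    deterministic integrand g: the L^2(P)-limit of the integrals of step
    functions converging to g in L^2([a,b]). *)
Definition wiener_integral (W : R -> Omega -> R) (a b : R) (g : R -> R)
  (Y : Omega -> R) : Prop :=
  measurable_fun setT Y /\
  exists (n : nat -> nat) (s c : nat -> nat -> R),
    [/\ (forall k, [/\ s k 0%N = a, s k (n k) = b &
                      forall i, (i < n k)%N -> s k i <= s k i.+1]),
        (fun k => \int[lebesgue_measure]_(u in `[a, b])
                     ((g u - step_fun (n k) (s k) (c k) u) ^+ 2)%:E)%E
          @ \oo --> 0%E &
        (fun k => \int[P]_w ((Y w - step_int W (n k) (s k) (c k) w) ^+ 2)%:E)%E
          @ \oo --> 0%E].
End Defs.

Definition U0 {R : realType} (delta0 x : R) : R := - delta0^-1 * expR (- delta0 * x).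

Definition admissible_reinsurance {R : realType} (T : R) (p1 p2 : R -> R) : Prop :=
  [/\ measurable_fun `[0, T] p1, measurable_fun `[0, T] p2 &
      forall t, 0 <= t <= T ->
        [/\ 0 <= p1 t <= 1, 0 <= p2 t <= 1 & 0 <= p1 t + p2 t <= 1]].

Definition admissible_premium {R : realType} (T : R) (theta : R -> R) : Prop :=
  [/\ measurable_fun `[0, T] theta,
      (forall t, 0 <= t <= T -> 0 < theta t) &
      exists M : R, forall t, 0 <= t <= T -> theta t <= M].

Section Control.
Context {R : realType} {d : measure_display} {Omega : measurableType d}.
Variables (P : probability Omega R) (W : R -> Omega -> R).
Variables (T c mu sigma delta0 : R) (theta1 theta2 : R -> R).

(** Terminal surplus X_0(T) started from X_0(t) = x under strategy p,
    given a version Y of  int_t^T (1 - p1 - p2) dW :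
    X_0(T) = x + int_t^T (c - mu - theta1 sigma^2 p1^2 - theta2 sigma^2 p2^2) ds
               - sigma * Y. *)
Definition terminal_surplus (t x : R) (p1 p2 : R -> R) (Y : Omega -> R)
  : Omega -> R :=
  fun w => x + Rintegral lebesgue_measure `[t, T]
                 (fun s => c - mu - theta1 s * sigma ^+ 2 * p1 s ^+ 2
                                  - theta2 s * sigma ^+ 2 * p2 s ^+ 2)
             - sigma * Y w.

Definition gain_set (t x : R) (p1 p2 : R -> R) : set (\bar R) :=
  [set (\int[P]_w (U0 delta0 (terminal_surplus t x p1 p2 Y w))%:E)%E
   | Y in [set Y | wiener_integral P W t T (fun s => 1 - p1 s - p2 s) Y]].

Definition value_function (t x : R) : \bar R :=
  ereal_sup [set e | exists p1 p2 : R -> R,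
                       admissible_reinsurance T p1 p2 /\ gain_set t x p1 p2 e].
End Control.

(* Main.v *)
(** A Wiener integral Y of a bounded deterministic g over [a, b] satisfies
    E exp(lam Y) = exp(lam^2/2 int g^2): for step functions this is independence
    of the increments and the Gaussian moment generating function, and it passes
    to the L^2 limit by truncating the exponential.  Hence the expected utility
    of a strategy is -(1/delta0) exp(-delta0 x + int_t^T cost), where cost is a
    deterministic running cost, and the control problem is a pointwise quadratic
    minimization under the integral sign.  The optimal value is attained because
    a Wiener integral of the optimal retention exists: it is the L^2 limit of the
    integrals of dyadic step functions, which are Cauchy since the second moment
    of a step integral is at most 8 times the squared L^2 norm of its integrand. *)
Require Import Defs.
From HB Require Import structures.
From mathcomp Require Import all_boot all_order all_algebra.
From mathcomp Require Import all_classical all_reals all_analysis.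
From mathcomp Require Import measurable_realfun ring lra.
Import Order.TTheory GRing.Theory Num.Theory.
Import numFieldNormedType.Exports.
Local Open Scope classical_set_scope.
Local Open Scope ring_scope.

(** * Independence and Gaussian moments *)

(** The exponential moment depends on the integrand only through its squared norm, so all versions
    of the Wiener integral give the same utility, and [gain_set] of an admissible strategy has at
    most one element. Dominating the value function therefore needs no existence result; only for
    the optimum must [gain_set] be shown nonempty. Convergence in L2 does not by itself carry
    exponential moments to the limit, because the exponential is unbounded. The remedy is that the
    moment generating function of a step integral is known at every point: its value at [2 * lam] is
    the second moment of the exponential at [lam], and controls the tails uniformly along the
    sequence. Second moments of step integrals are drawn from the same function, so it is the only
    Gaussian moment computed. *)

Section density.
Import HBNNSimple.

(** Change of variables and change of density in one statement, by simple functions and monotone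
    convergence. It serves with [phi] the identity and a Gaussian density, with [H = 1] to turn the
    law of an increment into expectations, and with [H] a product of independent factors. *)
Lemma ge0_integral_density d1 d2 (X : measurableType d1) (Y : measurableType d2)
    (R : realType) (phi : X -> Y) (mu : {measure set X -> \bar R})
    (nu : {measure set Y -> \bar R}) (H : X -> R) :
  measurable_fun setT phi -> measurable_fun setT H -> (forall x, 0 <= H x) ->
  (forall B, measurable B ->
    nu B = (\int[mu]_x ((\1_B (phi x))%:E * (H x)%:E))%E) ->
  forall f : Y -> \bar R, measurable_fun setT f -> (forall y, 0 <= f y)%E ->
  (\int[nu]_y f y = \int[mu]_x (f (phi x) * (H x)%:E))%E.
Proof.
move=> mphi mH H0 nuE f mf f0.
pose f_ := nnsfun_approx measurableT mf.
have mfphi n : measurable_fun [set: X] (fun x => ((f_ n (phi x))%:E * (H x)%:E)%E).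
  apply: emeasurable_funM; last exact/measurable_EFinP.
  by apply/measurable_EFinP; apply: measurableT_comp mphi; exact: measurable_funPT.
transitivity (limn (fun n => \int[nu]_y (f_ n y)%:E)%E).
  rewrite -monotone_convergence//.
  - by apply: eq_integral => y _; apply/esym/cvg_lim => //; exact: cvg_nnsfun_approx.
  - by move=> n; exact/measurable_EFinP/measurable_funPT.
  - by move=> n y _; rewrite lee_fin.
  - by move=> y _ m n mn; rewrite lee_fin; exact/lefP/nd_nnsfun_approx.
transitivity (limn (fun n => \int[mu]_x ((f_ n (phi x))%:E * (H x)%:E))%E); last first.
  rewrite -monotone_convergence//.
  - apply: eq_integral => x _; apply/cvg_lim => //.
    by apply: cvgeZr => //; exact: cvg_nnsfun_approx.
  - by move=> n x _; rewrite -EFinM lee_fin mulr_ge0.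
  - move=> x _ m n mn; rewrite -!EFinM lee_fin ler_wpM2r//.
    exact/lefP/nd_nnsfun_approx.
congr (limn _); apply/funext => n.
under eq_integral do rewrite fimfunE -fsumEFin//.
rewrite ge0_integral_fsum//; last 2 first.
- by move=> r; exact/measurable_EFinP/measurable_funM.
- by move=> r x _; rewrite nnfun_muleindic_ge0.
have mind r : measurable_fun [set: X]
    (fun x => ((\1_(f_ n @^-1` [set r]) (phi x))%:E * (H x)%:E)%E).
  apply: emeasurable_funM; last exact/measurable_EFinP.
  by apply/measurable_EFinP; apply: measurableT_comp mphi; exact: measurable_indic.
transitivity (\sum_(r \in range (f_ n))
    \int[mu]_x (r%:E * ((\1_(f_ n @^-1` [set r]) (phi x))%:E * (H x)%:E)))%E.
  apply: eq_fsbigr => r _; rewrite integralZl_indic_nnsfun// integral_indic//= setIT nuE//.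
  (* A negative [r] is never a value of the nonnegative [f_ n], so both sides vanish there. *)
  have [r0|r0] := leP 0 r.
    by rewrite ge0_integralZl_EFin// => x _; rewrite -EFinM lee_fin mulr_ge0.
  under eq_integral do rewrite preimage_nnfun0// indic0 mul0e.
  under [RHS]eq_integral do rewrite preimage_nnfun0// indic0 mul0e mule0.
  by rewrite !integral0 mule0.
rewrite -ge0_integral_fsum//.
- apply: eq_integral => x _; rewrite [in RHS]fimfunE -fsumEFin// ge0_mule_fsuml.
    by apply: eq_fsbigr => r _; rewrite EFinM muleA.
  by move=> r; rewrite nnfun_muleindic_ge0.
- by move=> r; exact/measurable_funeM.
- move=> r x _; rewrite muleA; apply: mule_ge0; last by rewrite lee_fin.
  by rewrite -EFinM; exact: nnfun_muleindic_ge0.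
Qed.

End density.

(** Completing the square: tilting the centred density by [expR (lam * x)] gives a constant times
    the Gaussian density with mean [lam * s ^+ 2], whose total mass is 1. *)
Lemma normal_mgf (R : realType) (s lam : R) : 0 < s ->
  (\int[normal_prob 0 s]_x (expR (lam * x))%:E = (expR (lam ^+ 2 * s ^+ 2 / 2))%:E)%E.
Proof.
move=> s0; have sn0 : s != 0 by rewrite gt_eqF.
rewrite (@ge0_integral_density _ _ _ _ _ id lebesgue_measure _ (normal_pdf 0 s)) //.
- transitivity (\int[lebesgue_measure]_x ((expR (lam ^+ 2 * s ^+ 2 / 2))%:E *
     (normal_pdf (lam * s ^+ 2) s x)%:E))%E.
    apply: eq_integral => x _; rewrite -!EFinM; congr EFin.
    rewrite !normal_pdfE// /normal_fun mulrCA [RHS]mulrCA; congr (_ * _).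
    by rewrite -!expRD; congr expR; field.
  rewrite ge0_integralZl_EFin ?expR_ge0//.
  + by rewrite integral_normal_pdf mule1.
  + by move=> x _; rewrite lee_fin normal_pdf_ge0.
  + by apply/measurable_EFinP; exact: measurable_normal_pdf.
- exact: measurable_normal_pdf.
- by move=> x; exact: normal_pdf_ge0.
- move=> B mB; rewrite [LHS]integral_mkcond.
  apply: eq_integral => x _; rewrite patchE indicE; case: ifP => _.
    by rewrite mul1e.
  by rewrite mul0e.
- by apply/measurable_EFinP; apply: measurableT_comp => //; exact: measurable_funM.
Qed.

Lemma integral_indic_comp d d' (T : measurableType d) (T' : measurableType d')
    (R : realType) (mu : {measure set T -> \bar R}) (X : T -> T') (A : set T') :
  measurable_fun setT X -> measurable A ->
  (\int[mu]_w (\1_A (X w))%:E = mu (X @^-1` A))%E.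
Proof.
move=> mX mA; rewrite -[in RHS](setIT (X @^-1` A)) -integral_indic//.
by rewrite -[X in measurable X]setTI; exact: mX.
Qed.

(* Starting from indicators, the [F i] are made general one coordinate at a time:
   the other factors serve as a density with respect to the law of [X k]. *)
Lemma expectation_prod_independent d (Omega : measurableType d) (R : realType)
    (P : probability Omega R) (X : nat -> Omega -> R) (n : nat) :
  (forall i, measurable_fun setT (X i)) ->
  (forall A : nat -> set R, (forall i, measurable (A i)) ->
    P (\bigcap_(i in [set i | (i < n)%N]) (X i @^-1` A i))
    = (\prod_(i < n) P (X i @^-1` A i))%E) ->
  forall F : nat -> R -> R, (forall i, measurable_fun setT (F i)) ->
  (forall i x, 0 <= F i x) ->
  (forall i, \int[P]_w (F i (X i w))%:E < +oo)%E ->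
  (\int[P]_w (\prod_(i < n) F i (X i w))%:E
    = \prod_(i < n) \int[P]_w (F i (X i w))%:E)%E.
Proof.
move=> mX indep F mF F0 Foo.
suff H k : (k <= n)%N -> forall F : nat -> R -> R,
    (forall i, measurable_fun setT (F i)) -> (forall i x, 0 <= F i x) ->
    (forall i, \int[P]_w (F i (X i w))%:E < +oo)%E ->
    (forall i, (k <= i < n)%N -> exists2 A, measurable A & F i = \1_A) ->
    (\int[P]_w (\prod_(i < n) F i (X i w))%:E
      = \prod_(i < n) \int[P]_w (F i (X i w))%:E)%E.
  by apply: (H n) => // i /andP[/leq_ltn_trans ni /ni]; rewrite ltnn.
elim: k {F mF F0 Foo} => [_|k IH kn] F mF F0 Foo Find.
  have /choice[A AP] : forall i, exists A, measurable A /\ ((i < n)%N -> F i = \1_A).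
    move=> i; have [/Find[A mA FA]|ni] := ltnP i n; first by exists A.
    by exists set0.
  have mA i : measurable (A i) by case: (AP i).
  have mXA i : measurable (X i @^-1` A i) by rewrite -[X in measurable X]setTI; exact: mX.
  have FA i : (i < n)%N -> F i = \1_(A i) by case: (AP i).
  transitivity (\int[P]_w (\1_(\bigcap_(i in [set i | (i < n)%N]) (X i @^-1` A i)) w)%:E)%E.
    apply: eq_integral => w _; congr EFin.
    under eq_bigr => i _ do rewrite FA// indicE.
    rewrite indicE -natr_prod; congr (_%:R).
    have [|] := boolP (w \in _).
      move=> /set_mem wA; rewrite big1// => i _.
      by rewrite mem_set//; exact: (wA i (ltn_ord i)).
    apply: contraNeq => p0; apply/mem_set => i /= ni; apply/set_mem.
    by move: p0; rewrite (bigD1 (Ordinal ni))//=; case: (_ \in _).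
  rewrite (integral_indic P measurableT); last first.
    by apply: bigcap_measurableType => i _; exact: mXA.
  rewrite setIT; transitivity (\prod_(i < n) P (X i @^-1` A i))%E; first exact: indep.
  by apply: eq_bigr => i _; rewrite FA// integral_indic_comp.
pose i0 := Ordinal kn.
pose m i := fine (\int[P]_w (F i (X i w))%:E)%E.
have m0 i : 0 <= m i by rewrite fine_ge0// integral_ge0// => w _; rewrite lee_fin.
have mE i : (\int[P]_w (F i (X i w))%:E = (m i)%:E)%E.
  by rewrite fineK// ge0_fin_numE// integral_ge0// => w _; rewrite lee_fin.
have C0 : 0 <= \prod_(i < n | i != i0) m i by apply: prodr_ge0.
pose C := NngNum C0.
pose Xk : {mfun Omega >-> R} :=
  HB.pack (X k) (isMeasurableFun.Build _ _ _ _ (X k) (mX k)).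
(* By independence, weighting the law of [X k] by [H] merely rescales it by [C], the product of the
   other means, a real number because all means are finite. The induction hypothesis, with an
   indicator in place of [F k], proves this. *)
pose nu := mscale C (distribution P Xk).
pose H w := \prod_(i < n | i != i0) F i (X i w).
have mFX i : measurable_fun setT (fun w => F i (X i w)) by exact: measurableT_comp.
have H0 w : 0 <= H w by apply: prodr_ge0.
have mH : measurable_fun setT H.
  have -> : H = fun w => \prod_(i < n) (if i != i0 then F i (X i w) else 1).
    by apply/funext => w; rewrite /H big_mkcond.
  apply: (@measurable_prod _ _ _ setT _ _
    (fun (i : 'I_n) w => if i != i0 then F i (X i w) else 1)) => i _.
  by case: (i != i0) => //; exact: measurable_cst.
transitivity (\int[P]_w ((F k (X k w))%:E * (H w)%:E))%E.
  by apply: eq_integral => w _; rewrite (bigD1 i0)//= EFinM.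
rewrite -(@ge0_integral_density _ _ _ _ _ (X k) P nu H (mX k) mH H0 _ (EFin \o F k)); last 3 first.
- move=> B mB.
  pose F' i := if i == k then \1_B else F i.
  transitivity (\int[P]_w (\prod_(i < n) F' i (X i w))%:E)%E; last first.
    apply: eq_integral => w _; rewrite (bigD1 i0)//= /F' eqxx EFinM; congr (_ * _%:E)%E.
    by apply: eq_bigr => i ik; rewrite ifN.
  rewrite IH; last 5 first.
  + exact: ltnW.
  + by move=> i; rewrite /F'; case: ifP.
  + by move=> i x; rewrite /F'; case: ifP.
  + move=> i; rewrite /F'; case: eqP => [->|//].
    rewrite integral_indic_comp//.
    apply: le_lt_trans (ltry 1); apply: probability_le1.
    by rewrite -[X in measurable X]setTI; exact: (mX k measurableT B mB).
  + move=> i /andP[]; rewrite leq_eqVlt => /predU1P[<-|ki] ni; rewrite /F'.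
      by rewrite eqxx; exists B.
    by rewrite gtn_eqF//; apply: Find; rewrite ki.
  rewrite (bigD1 i0)//= [in RHS]/F' eqxx integral_indic_comp//.
  rewrite /nu /mscale/= muleC; congr (_ * _)%E.
  rewrite -prodEFin; apply: eq_bigr => i ik; rewrite /F' ifN// mE//.
- exact/measurable_EFinP.
- by move=> y; rewrite lee_fin.
rewrite /nu ge0_integral_mscale//; last 2 first.
- exact/measurable_EFinP.
- by move=> y _; rewrite lee_fin.
rewrite ge0_integral_distribution//; last 2 first.
- exact/measurable_EFinP.
- by move=> y; rewrite lee_fin.
rewrite (bigD1 i0)//= muleC; congr (_ * _)%E.
by rewrite -prodEFin; apply: eq_bigr => i _; rewrite mE.
Qed.

Lemma integral_cst_probability d (T : measurableType d) (R : realType)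
    (P : probability T R) (r : R) : (\int[P]_w r%:E = r%:E)%E.
Proof.
rewrite integral_cst//; transitivity (r%:E * 1)%E; last exact: mule1.
by congr (_ * _)%E; exact: probability_setT.
Qed.

Lemma expR_sum (R : realType) n (F : nat -> R) :
  expR (\sum_(i < n) F i) = \prod_(i < n) expR (F i).
Proof.
by elim/big_ind2: _ => //; [exact: expR0|move=> x1 x2 y1 y2 <- <-; rewrite expRD].
Qed.

(* Degenerate steps carry no weight, so they can be skipped. *)
Lemma strict_partition (R : realType) (n : nat) (s c : nat -> R) :
  (forall i, (i < n)%N -> s i <= s i.+1) ->
  exists (m : nat) (s' c' : nat -> R),
    [/\ s' 0%N = s 0%N, s' m = s n, forall i, (i < m)%N -> s' i < s' i.+1 &
      forall G : R -> R -> R -> R, (forall a x, G a x x = 0) ->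
        \sum_(i < n) G (c i) (s i) (s i.+1)
        = \sum_(i < m) G (c' i) (s' i) (s' i.+1)].
Proof.
elim: n => [_|n IH ns].
  by exists 0%N, s, c; split => // G _; rewrite !big_ord0.
have [|m [s' [c' [s0 sm sS sG]]]] := IH; first by move=> i ni; exact/ns/ltnW.
have := ns n (ltnSn n); rewrite le_eqVlt => /predU1P[nE|nlt].
  exists m, s', c'; split => //; first by rewrite sm.
  by move=> G G0; rewrite big_ord_recr/= nE G0 addr0 sG.
exists m.+1, (fun i => if (i <= m)%N then s' i else s n.+1),
  (fun i => if (i < m)%N then c' i else c n); split.
- by rewrite leq0n.
- by rewrite /= ltnn.
- move=> i; rewrite ltnS leq_eqVlt => /predU1P[->|im].
    by rewrite eqxx ltnn sm.
  by rewrite im orbT; exact: sS.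
- move=> G G0; rewrite !big_ord_recr/= ltnn leqnn sm; congr (_ + _).
  rewrite sG//; apply: eq_bigr => i _.
  by rewrite (ltn_ord i) ltnW// (ltn_ord i).
Qed.

(** * Integrals of step functions *)

Section brownian_steps.
Context {R : realType} {d : measure_display} {Omega : measurableType d}.
Variables (P : probability Omega R) (W : R -> Omega -> R).
Hypothesis BM : is_brownian_motion P W.

Let measurable_W t : measurable_fun setT (W t).
Proof. by case: BM. Qed.

Lemma measurable_increment (s t : R) : measurable_fun setT (increment W s t).
Proof. exact: measurable_funB. Qed.

Lemma measurable_step_int n (s c : nat -> R) : measurable_fun setT (step_int W n s c).
Proof.
apply: (@measurable_sum _ _ _ setT _ _
  (fun (i : 'I_n) w => c i * (W (s i.+1) w - W (s i) w))) => i.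
by apply: measurable_funM => //; exact: measurable_increment.
Qed.

Lemma increment_mgf (s t lam : R) : 0 <= s -> s < t ->
  (\int[P]_w (expR (lam * increment W s t w))%:E = (expR (lam ^+ 2 * (t - s) / 2))%:E)%E.
Proof.
move=> s0 st.
have sd : 0 < Num.sqrt (t - s) by rewrite sqrtr_gt0 subr_gt0.
have <- : Num.sqrt (t - s) ^+ 2 = t - s by rewrite sqr_sqrtr// subr_ge0 ltW.
rewrite -normal_mgf//.
rewrite (ge0_integral_density _ _ Omega (measurableTypeR R) R (increment W s t) P _ (cst 1)) //.
- by apply: eq_integral => w _; rewrite mule1.
- exact: measurable_increment.
- move=> B mB; under eq_integral do rewrite mule1.
  rewrite integral_indic_comp//; last exact: measurable_increment.
  by case: BM => _ _ _ /(_ _ _ s0 st B mB)/esym.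
- by apply/measurable_EFinP; apply: measurableT_comp => //; exact: measurable_funM.
Qed.

Lemma step_int_mgf n (s c : nat -> R) (lam : R) : 0 <= s 0%N ->
  (forall i, (i < n)%N -> s i <= s i.+1) ->
  (\int[P]_w (expR (lam * step_int W n s c w))%:E
   = (expR (lam ^+ 2 / 2 * \sum_(i < n) c i ^+ 2 * (s i.+1 - s i)))%:E)%E.
Proof.
move=> s00 /(strict_partition _ _ _ c)[m [s' [c' [s0 sm sS sG]]]].
rewrite (sG (fun c x y => c ^+ 2 * (y - x))); last by move=> *; rewrite subrr mulr0.
transitivity (\int[P]_w (expR (lam * step_int W m s' c' w))%:E)%E.
  apply: eq_integral => w _; rewrite /step_int.
  rewrite (sG (fun c x y => c * (W y w - W x w)))//.
  by move=> *; rewrite subrr mulr0.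
rewrite -s0 in s00.
(* Past [m] the times are arbitrary; the constant 1 keeps the mean finite at every index, as the
   product formula requires. *)
pose F i x := if (i < m)%N then expR (lam * c' i * x) else 1.
have sge i : (i <= m)%N -> 0 <= s' i.
  elim: i => // i IH im; rewrite (le_trans (IH (ltnW im)))// ltW//; exact: sS.
have EF (i : nat) : (i < m)%N -> (\int[P]_w (F i (increment W (s' i) (s' i.+1) w))%:E
    = (expR (lam ^+ 2 / 2 * (c' i ^+ 2 * (s' i.+1 - s' i))))%:E)%E.
  move=> im; rewrite /F im increment_mgf; last 2 first.
  - exact/sge/ltnW.
  - exact: sS.
  by congr (expR _)%:E; field.
transitivity (\int[P]_w (\prod_(i < m) F i (increment W (s' i) (s' i.+1) w))%:E)%E.
  apply: eq_integral => w _; rewrite /step_int mulr_sumr.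
  rewrite (expR_sum _ _ (fun i => lam * (c' i * (W (s' i.+1) w - W (s' i) w)))).
  congr EFin; apply: eq_bigr => i _.
  by rewrite /F ltn_ord mulrA.
rewrite (expectation_prod_independent _ _ _ _ (fun i => increment W (s' i) (s' i.+1))).
- transitivity (\prod_(i < m) (expR (lam ^+ 2 / 2 * (c' i ^+ 2 * (s' i.+1 - s' i))))%:E)%E.
    by apply: eq_bigr => i _; exact: EF.
  rewrite prodEFin; congr EFin.
  by rewrite mulr_sumr (expR_sum _ _ (fun i => lam ^+ 2 / 2 * (c' i ^+ 2 * (s' i.+1 - s' i)))).
- by move=> i; exact: measurable_increment.
- by move=> A mA; case: BM => _ _ _ _ /(_ m s' A s00 sS mA).
- move=> i; rewrite /F; case: (i < m)%N => //.
  by apply: measurableT_comp => //; exact: measurable_funM.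
- by move=> i x; rewrite /F; case: ifP => // _; exact: expR_ge0.
- move=> i; have [im|im] := ltnP i m; first by rewrite EF// ltry.
  under eq_integral do rewrite /F ltnNge im/=.
  by rewrite integral_cst_probability ltry.
Qed.

(** For [0 <= x], squaring [1 + x / 2 <= expR (x / 2)] produces the term [x ^+ 2 / 4], and adding
    [1 - x <= expR (- x)] cancels the linear part. *)
Lemma sqr_le_expR (x : R) : x ^+ 2 / 4 + 2 <= expR x + expR (- x).
Proof.
wlog x0 : x / 0 <= x => [H|].
  have [/H//|/ltW] := leP 0 x; rewrite -oppr_ge0 => /H.
  by rewrite sqrrN opprK [leRHS]addrC.
have h1 := expR_ge1Dx (x / 2); have h2 := expR_ge1Dx (- x).
have -> : expR x = expR (x / 2) ^+ 2 by rewrite -expRM_natr -mulr_natr divfK.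
nra.
Qed.

(* The constant is not optimal: 8 instead of 1 comes from bounding the square by
   exponentials, so that the moment generating function suffices. *)
Lemma step_int_sqr_le n (s c : nat -> R) : 0 <= s 0%N ->
  (forall i, (i < n)%N -> s i <= s i.+1) ->
  (\int[P]_w (step_int W n s c w ^+ 2)%:E
   <= (8 * \sum_(i < n) c i ^+ 2 * (s i.+1 - s i))%:E)%E.
Proof.
move=> s0 sS; set v := \sum_(i < n) _.
have v0 : 0 <= v.
  by apply: sumr_ge0 => i _; rewrite mulr_ge0 ?sqr_ge0// subr_ge0 sS.
have mS := measurable_step_int n s c.
have mS2 : measurable_fun setT (fun w => (step_int W n s c w ^+ 2)%:E).
  by apply/measurable_EFinP; exact: measurable_funX.
have key lam : 0 <= lam ->
    ((lam ^+ 2 / 4)%:E * \int[P]_w (step_int W n s c w ^+ 2)%:E + 2%:E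
      <= (2 * expR (lam ^+ 2 / 2 * v))%:E)%E.
  move=> lam0.
  have me t : measurable_fun setT (fun w => (expR (t * step_int W n s c w))%:E).
    by apply/measurable_EFinP; apply: measurableT_comp => //; exact: measurable_funM.
  have -> : ((2 * expR (lam ^+ 2 / 2 * v))%:E =
      \int[P]_w ((expR (lam * step_int W n s c w))%:E
        + (expR (- lam * step_int W n s c w))%:E))%E.
    rewrite ge0_integralD//; try by move=> w _; rewrite lee_fin expR_ge0.
    by rewrite !step_int_mgf// sqrrN -EFinD mulr2n mulrDl mul1r.
  rewrite -ge0_integralZl_EFin//; last 2 first.
  - by move=> w _; rewrite lee_fin sqr_ge0.
  - by rewrite divr_ge0// sqr_ge0.
  have <- : (\int[P]_w (cst 2%:E w) = 2%:E)%E.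
    exact: integral_cst_probability.
  rewrite -ge0_integralD//; last 3 first.
  - by move=> w _; rewrite -EFinM lee_fin mulr_ge0// ?sqr_ge0// divr_ge0// sqr_ge0.
  - exact: measurable_funeM.
  - by move=> w _; rewrite lee_fin.
  apply: ge0_le_integral => //.
  - move=> w _; rewrite -EFinM -EFinD lee_fin addr_ge0// mulr_ge0// ?sqr_ge0//.
    by rewrite divr_ge0// sqr_ge0.
  - by apply: emeasurable_funD => //; exact: measurable_funeM.
  - exact: emeasurable_funD.
  - move=> w _; rewrite -EFinM -!EFinD lee_fin mulNr.
    by rewrite (le_trans _ (sqr_le_expR _))// exprMn; lra.
set I := (\int[P]_w (step_int W n s c w ^+ 2)%:E)%E in key *.
have [v00|vn0] := eqVneq v 0.
  have := key 1 ler01; rewrite v00 !mulr0 expR0 mulr1 expr1n -leeBrDr//.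
  rewrite -EFinB subrr.
  by rewrite -[leRHS](mule0 (1 / 4)%:E) lee_pmul2l.
have vgt0 : 0 < v by rewrite lt0r vn0.
(* With [lam ^+ 2 = v^-1] the exponent in [key] is 1/2, and [expR (1 / 2) <= 2] leaves at most
   [4 * v * (2 * 2 - 2) = 8 * v]; hence the separate treatment of [v = 0] above. *)
have := key (Num.sqrt v^-1) (sqrtr_ge0 _).
rewrite sqr_sqrtr ?invr_ge0// -leeBrDr// -EFinB -lee_pdivlMl; last first.
  by rewrite divr_gt0// invr_gt0.
move=> /le_trans; apply; rewrite -EFinM lee_fin invfM invrK invrK.
have -> : v^-1 / 2 * v = 1 / 2 by field.
have h : expR (1 / 2) <= 2 :> R.
  have := expR_ge1Dx (- (1 / 2) : R); rewrite expRN.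
  rewrite (_ : 1 + - (1/2) = 2^-1); last by field.
  by rewrite lef_pV2// posrE// expR_gt0.
nra.
Qed.

End brownian_steps.

Section square_step_fun.
Context {R : realType}.
Implicit Types s c : nat -> R.

Lemma partition_le n s : (forall i, (i < n)%N -> s i <= s i.+1) ->
  forall i j, (i <= j <= n)%N -> s i <= s j.
Proof.
move=> sS i; elim=> [|j IH]; first by rewrite leqn0 => /andP[/eqP ->].
move=> /andP[]; rewrite leq_eqVlt => /predU1P[->//|]; rewrite ltnS => ij jn.
by apply: le_trans (sS _ jn); apply: IH; rewrite ij ltnW.
Qed.

(** The half-open cells are disjoint, so there are no cross terms: at each [u] either the last cell
    or all the earlier ones contribute nothing. *)
Lemma sqr_step_fun n s c u : (forall i, (i < n)%N -> s i <= s i.+1) ->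
  step_fun n s c u ^+ 2 = \sum_(i < n) c i ^+ 2 * \1_(`[s i, s i.+1[) u.
Proof.
elim: n => [|n IH] sS; first by rewrite /step_fun !big_ord0 expr0n.
have sS' i : (i < n)%N -> s i <= s i.+1 by move=> ni; exact/sS/ltnW.
rewrite /step_fun big_ord_recr/= -/(step_fun n s c u) [RHS]big_ord_recr/= -IH//.
have [nu|un] := leP (s n) u.
  have -> : step_fun n s c u = 0.
    rewrite /step_fun big1// => i _; rewrite indicE memNset ?mulr0//=.
    rewrite in_itv/= => /andP[_]; apply/negP; rewrite -leNgt (le_trans _ nu)//.
    by apply: (partition_le n) => //; rewrite ltn_ord leqnn.
  rewrite !add0r expr0n/= add0r exprMn; congr (_ * _).
  by rewrite indicE; case: (_ \in _); rewrite ?expr1n ?expr0n.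
have -> : \1_(`[s n, s n.+1[) u = 0 :> R.
  by rewrite indicE memNset//= in_itv/= leNgt un.
by rewrite !mulr0 !addr0.
Qed.

Lemma measurable_step_fun n s c (D : set R) : measurable_fun D (step_fun n s c).
Proof.
apply: (@measurable_sum _ _ _ D _ _ (fun (i : 'I_n) u => c i * \1_(`[s i, s i.+1[) u)) => i.
by apply: measurable_funM => //; exact: measurable_indic.
Qed.

(** The right-hand side is also the variance appearing in [step_int_mgf], so this identity carries
    L2 estimates on the time axis over to the probability space. *)
Lemma integral_sqr_step_fun n s c a b : s 0%N = a -> s n = b ->
  (forall i, (i < n)%N -> s i <= s i.+1) ->
  (\int[lebesgue_measure]_(u in `[a, b]) (step_fun n s c u ^+ 2)%:E
   = (\sum_(i < n) c i ^+ 2 * (s i.+1 - s i))%:E)%E.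
Proof.
move=> <- <- sS.
under eq_integral do rewrite sqr_step_fun// -sumEFin.
rewrite ge0_integral_sum//=; last 2 first.
- move=> i; apply/measurable_EFinP; apply: measurable_funM => //; exact: measurable_indic.
- by move=> i u _; rewrite lee_fin mulr_ge0// sqr_ge0.
rewrite -sumEFin; apply: eq_bigr => i _.
under eq_integral do rewrite EFinM.
rewrite ge0_integralZl_EFin ?sqr_ge0//; last first.
  by apply/measurable_EFinP; exact: measurable_indic.
rewrite [RHS]EFinM integral_indic//=; congr (_ * _)%E.
rewrite setIidl; last first.
  apply: subset_itv; rewrite bnd_simp; first by apply: (partition_le n) => //=; exact: ltnW.
  by apply: (partition_le n) => //; rewrite ltn_ord leqnn.
rewrite lebesgue_measure_itv/= lte_fin.
have := sS i (ltn_ord i); rewrite le_eqVlt => /predU1P[->|->//].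
by rewrite ltxx subrr.
Qed.

End square_step_fun.

(** Most L2 estimates below are pointwise inequalities integrated through this lemma, with zero in
    the slots left over. For nonnegative functions it holds in the extended reals, so no
    integrability has to be checked. *)
Lemma ge0_integral_le_comb d (T : measurableType d) (R : realType)
    (mu : {measure set T -> \bar R}) (D : set T) (f g h1 h2 h3 : T -> R)
    (C1 C2 C3 : R) : measurable D ->
  measurable_fun D f -> measurable_fun D g ->
  measurable_fun D h1 -> measurable_fun D h2 -> measurable_fun D h3 ->
  (forall x, 0 <= f x) -> (forall x, 0 <= g x) ->
  (forall x, 0 <= h1 x) -> (forall x, 0 <= h2 x) -> (forall x, 0 <= h3 x) ->
  0 <= C1 -> 0 <= C2 -> 0 <= C3 ->
  (forall x, D x -> f x <= g x + (C1 * h1 x + (C2 * h2 x + C3 * h3 x))) ->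
  (\int[mu]_(x in D) (f x)%:E <= \int[mu]_(x in D) (g x)%:E +
    (C1%:E * \int[mu]_(x in D) (h1 x)%:E + (C2%:E * \int[mu]_(x in D) (h2 x)%:E
     + C3%:E * \int[mu]_(x in D) (h3 x)%:E)))%E.
Proof.
move=> mD mf mg m1 m2 m3 f0 g0 h10 h20 h30 C10 C20 C30 H.
have mZ (h : T -> R) C : measurable_fun D h -> measurable_fun D (fun x => (C%:E * (h x)%:E)%E).
  by move=> mh; apply: measurable_funeM; exact/measurable_EFinP.
have Z0 (h : T -> R) C : (forall x, 0 <= h x) -> 0 <= C ->
    (forall x, D x -> (0 <= C%:E * (h x)%:E)%E).
  by move=> h0 C0 x _; rewrite -EFinM lee_fin mulr_ge0.
have ZE (h : T -> R) C : measurable_fun D h -> (forall x, 0 <= h x) -> 0 <= C ->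
    (C%:E * \int[mu]_(x in D) (h x)%:E = \int[mu]_(x in D) (C%:E * (h x)%:E))%E.
  move=> mh h0 C0; rewrite ge0_integralZl_EFin//.
  - by move=> x _; rewrite lee_fin.
  - exact/measurable_EFinP.
rewrite !ZE// -!ge0_integralD//; try by [exact: mZ|exact: Z0|exact/measurable_EFinP|
  exact: emeasurable_funD (mZ _ _ _) (mZ _ _ _)|move=> x Dx; rewrite ?adde_ge0 ?Z0 ?lee_fin|
  apply: emeasurable_funD; [exact: mZ|apply: emeasurable_funD; exact: mZ]].
apply: ge0_le_integral => //.
- by move=> x _; rewrite lee_fin.
- exact/measurable_EFinP.
- apply: emeasurable_funD; first exact/measurable_EFinP.
  by apply: emeasurable_funD; [exact: mZ|apply: emeasurable_funD; exact: mZ].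
Qed.

(** * Squared norms under L2 convergence *)

Section limits.
Local Open Scope ereal_scope.

Lemma cvge0_le (R : realType) (u : nat -> \bar R) (e : R) :
  (0 < e)%R -> u @ \oo --> 0 -> \forall n \near \oo, u n <= e%:E.
Proof.
move=> e0 /fine_cvgP[ufin /cvgrPdist_le/(_ e e0) uc].
near=> n.
rewrite -(fineK (_ : u n \is a fin_num)); last by near: n.
have : (`|0 - fine (u n)| <= e)%R by near: n.
by rewrite sub0r normrN ler_norml lee_fin => /andP[].
Unshelve. all: by end_near. Qed.

Lemma cvg_integral_sqr d (T : measurableType d) (R : realType)
    (mu : {measure set T -> \bar R}) (D : set T) (g : T -> R)
    (f : nat -> T -> R) (A : R) (B : nat -> R) : measurable D ->
  measurable_fun D g -> (forall k, measurable_fun D (f k)) ->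
  \int[mu]_(x in D) (g x ^+ 2)%:E = A%:E ->
  (forall k, \int[mu]_(x in D) (f k x ^+ 2)%:E = (B k)%:E) ->
  (fun k => \int[mu]_(x in D) ((g x - f k x) ^+ 2)%:E) @ \oo --> 0 ->
  (B @ \oo --> A)%R.
Proof.
move=> mD mg mf gA fB h.
have A0 : (0 <= A)%R by rewrite -lee_fin -gA integral_ge0// => x _; rewrite lee_fin sqr_ge0.
apply/cvgrPdist_le => e e0.
(* Since [e1 <= 1], the estimate [key] below gives [B k <= 2 * A + 2], so both one-sided errors are
   at most [e1 * (2 * A + 4)]. *)
pose e1 := Num.min 1%R (e / (2 * A + 6))%R.
have d0 : (0 < 2 * A + 6)%R by lra.
have e10 : (0 < e1)%R by rewrite lt_min ltr01 divr_gt0.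
have e11 : (e1 <= 1)%R by rewrite ge_min lexx.
have e1e : (e1 * (2 * A + 6) <= e)%R by rewrite -ler_pdivlMr// ge_min lexx orbT.
near=> k.
have Dk : \int[mu]_(x in D) ((g x - f k x) ^+ 2)%:E <= (e1 ^+ 2)%:E.
  by near: k; apply: cvge0_le => //; rewrite exprn_gt0.
set I := (\int[mu]_(x in D) ((g x - f k x) ^+ 2)%:E) in Dk.
have I0 : 0 <= I by apply: integral_ge0 => x _; rewrite lee_fin sqr_ge0.
have If : I \is a fin_num by rewrite ge0_fin_numE// (le_lt_trans Dk) ?ltry.
have msq (h0 : T -> R) : measurable_fun D h0 -> measurable_fun D (fun x => h0 x ^+ 2)%R.
  by move=> ?; exact: measurable_funX.
have mgf : measurable_fun D (fun x => (g x - f k x) ^+ 2)%R by apply/msq/measurable_funB.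
have C0 : (0 <= 1 + e1^-1)%R by rewrite addr_ge0// invr_ge0 ltW.
(* Weighted Young inequality in place of the triangle inequality for the norm: as the squared
   distance is at most [e1 ^+ 2], its term costs at most [2 * e1]. *)
have h1 (a b : R) : (a ^+ 2 <= b ^+ 2 + (e1 * b ^+ 2 + ((1 + e1^-1) * (a - b) ^+ 2 + 0 * 0)))%R.
  have : (0 <= e1 * (b - e1^-1 * (a - b)) ^+ 2)%R by rewrite mulr_ge0 ?sqr_ge0// ltW.
  have -> : (e1 * (b - e1^-1 * (a - b)) ^+ 2 
      = e1 * b ^+ 2 - 2 * b * (a - b) + e1^-1 * (a - b) ^+ 2)%R.
    by field; rewrite gt_eqF.
  nra.
have key (u v : T -> R) (a b : R) : measurable_fun D u -> measurable_fun D v ->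
    (forall x, (u x - v x) ^+ 2 = (g x - f k x) ^+ 2)%R ->
    \int[mu]_(x in D) (u x ^+ 2)%:E = a%:E ->
    \int[mu]_(x in D) (v x ^+ 2)%:E = b%:E -> (a <= b + e1 * b + 2 * e1)%R.
  move=> mu' mv uv ua vb.
  have := @ge0_integral_le_comb _ T R mu D (fun x => u x ^+ 2)%R (fun x => v x ^+ 2)%R
    (fun x => v x ^+ 2)%R (fun x => (g x - f k x) ^+ 2)%R (fun=> 0%R) e1 (1 + e1^-1)%R 0%R
    mD (msq _ mu') (msq _ mv) (msq _ mv) mgf (measurable_cst _)
    (fun=> sqr_ge0 _) (fun=> sqr_ge0 _) (fun=> sqr_ge0 _) (fun=> sqr_ge0 _)
    (fun=> lexx _) (ltW e10) C0 (lexx _).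
  rewrite -/I ua vb mul0e adde0 => /(_ _)/wrap[].
    by move=> x _; rewrite -uv; exact: h1.
  rewrite -(fineK If) -!EFinM -!EFinD lee_fin => /le_trans; apply.
  rewrite -addrA lerD2l lerD2l.
  have : (fine I <= e1 ^+ 2)%R by rewrite -lee_fin fineK.
  have i0 : (0 <= fine I)%R by rewrite fine_ge0.
  move=> H; rewrite (le_trans (ler_wpM2l C0 H))//.
  rewrite mulrDl mul1r expr2 mulrA mulVf ?gt_eqF// mul1r.
  by rewrite mulr2n mulrDl !mul1r lerD2r; nra.
have := key g (f k) A (B k) mg (mf k) (fun=> erefl) gA (fB k).
have := key (f k) g (B k) A (mf k) mg _ (fB k) gA.
move=> /(_ (fun x => _))/wrap[]; first by move=> x; rewrite -sqrrN opprB.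
rewrite ler_norml => H1 H2.
have : (e1 * B k <= e1 * (2 * A + 2))%R by rewrite ler_wpM2l ?(ltW e10)//; nra.
move=> H3.
by apply/andP; split; nra.
Unshelve. all: by end_near. Qed.

End limits.

(** The exponential has slope at most [M] as long as it stays below [M]. The tangent bound
    [1 + u <= expR u] at [u = y - x] replaces the mean value theorem. *)
Lemma min_expR_lipschitz (R : realType) (M x y : R) : 0 < M ->
  Num.min (expR x) M <= Num.min (expR y) M + M * `|x - y|.
Proof.
move=> M0; have [xy|yx] := leP x y.
  have : Num.min (expR x) M <= Num.min (expR y) M.
    by rewrite le_min !ge_min lexx orbT ler_expR xy.
  by move/le_trans; apply; rewrite lerDl mulr_ge0// ltW.
rewrite ger0_norm ?subr_ge0 ?(ltW yx)//.
have [My|yM] := leP M (expR y).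
  by rewrite (le_trans (_ : _ <= M)) ?ge_min ?lexx ?orbT// lerDl mulr_ge0// ?subr_ge0 ltW.
set z := Num.min _ _.
have z0 : 0 <= z by rewrite le_min expR_ge0 ltW.
have zM : z <= M by rewrite ge_min lexx orbT.
have zx : z <= expR x by rewrite ge_min lexx.
have h1 : z * (1 + (y - x)) <= z * expR (y - x) by rewrite ler_wpM2l// expR_ge1Dx.
have h2 : z * expR (y - x) <= expR y.
  have -> : expR y = expR x * expR (y - x) by rewrite -expRD addrC subrK.
  by rewrite ler_wpM2r// expR_ge0.
have h3 : z * (x - y) <= M * (x - y) by rewrite ler_wpM2r// subr_ge0 ltW.
nra.
Qed.

(** Turns the linear error of a Lipschitz estimate into an arbitrarily small constant plus a
    multiple of the square, which is what L2 convergence controls. *)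
Lemma amgm_scaled (R : realType) (M e t : R) : 0 < e -> 0 <= t ->
  M * t <= e + M ^+ 2 / e * t ^+ 2.
Proof.
move=> e0 t0; have : 0 <= e * (1 - M / e * t) ^+ 2 by rewrite mulr_ge0 ?sqr_ge0// ltW.
have -> : e * (1 - M / e * t) ^+ 2 = e - 2 * (M * t) + M ^+ 2 / e * t ^+ 2.
  by field; rewrite gt_eqF.
have [Mt0|Mt0] := leP 0 (M * t); first by lra.
move=> _; rewrite (le_trans (ltW Mt0))// addr_ge0 ?(ltW e0)// mulr_ge0 ?sqr_ge0//.
by rewrite divr_ge0 ?sqr_ge0// ltW.
Qed.

(** * Exponential moments under L2 convergence *)

(* The truncation [min (exp y) M] is Lipschitz, so its mean passes to the limit;
   what it cuts off from [exp (S k)] is at most [exp (S k) ^ 2 / M]. *)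
Section exponential_moment_limit.
Context {R : realType} {d : measure_display} {Omega : measurableType d}.
Variables (P : probability Omega R) (S : nat -> Omega -> R) (Y : Omega -> R).
Hypotheses (mS : forall k, measurable_fun setT (S k)) (mY : measurable_fun setT Y).
Variables (m m2 : nat -> R) (L K : R).
Hypothesis mE : forall k, (\int[P]_w (expR (S k w))%:E = (m k)%:E)%E.
Hypothesis m2E : forall k, (\int[P]_w (expR (S k w) ^+ 2)%:E = (m2 k)%:E)%E.
Hypotheses (mL : m @ \oo --> L) (m2K : m2 @ \oo --> K).
Hypothesis SY : (fun k => \int[P]_w ((Y w - S k w) ^+ 2)%:E)%E @ \oo --> 0%E.

Let mexp (X : Omega -> R) : measurable_fun setT X ->
  measurable_fun setT (fun w => expR (X w)).
Proof. by move=> mX; exact: measurableT_comp. Qed.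

Let mD k : measurable_fun setT (fun w => (Y w - S k w) ^+ 2).
Proof. by apply: measurable_funX; exact: measurable_funB. Qed.

Let mminY (M : R) : measurable_fun setT (fun w => Num.min (expR (Y w)) M).
Proof. by apply: measurable_minr => //; exact: mexp. Qed.

Let truncated_le (M e : R) : 0 < M -> 0 < e ->
  (\int[P]_w (Num.min (expR (Y w)) M)%:E <= (L + e)%:E)%E.
Proof.
(* One third each for the constant in [amgm_scaled], the L2 distance and the distance from [m k] to
   [L]. *)
move=> M0 e0; pose e3 := e / 3; have e30 : 0 < e3 by rewrite divr_gt0.
pose C := M ^+ 2 / e3; have C0 : 0 < C by rewrite divr_gt0// exprn_gt0.
have [k [Dk mk]] : exists k, (\int[P]_w ((Y w - S k w) ^+ 2)%:E <= (e3 / C)%:E)%E /\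
    `|L - m k| <= e3.
  have h1 := cvge0_le _ _ _ (divr_gt0 e30 C0) SY.
  have /cvgrPdist_le/(_ _ e30) h2 := mL.
  by have [k _ hk] := filterI h1 h2; exists k; exact: (hk k (leqnn k)).
have := @ge0_integral_le_comb _ _ R P setT (fun w => Num.min (expR (Y w)) M)
  (fun w => expR (S k w)) (cst 1) (fun w => (Y w - S k w) ^+ 2) (cst 0) e3 C 0
  measurableT (mminY M) (mexp _ (mS k)) (measurable_cst _) (mD k) (measurable_cst _)
  _ (fun=> expR_ge0 _) (fun=> ler01) (fun=> sqr_ge0 _) (fun=> lexx _)
  (ltW e30) (ltW C0) (lexx _).
rewrite integral_cst_probability mE mul0e adde0 => /(_ _ _)/wrap[].
- by move=> w; rewrite le_min expR_ge0 ltW.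
- move=> w _; rewrite /= mulr1 mulr0 addr0.
  rewrite (le_trans (min_expR_lipschitz _ M (Y w) (S k w) M0))// lerD//.
    by rewrite ge_min lexx.
  by rewrite (le_trans (amgm_scaled _ _ e3 _ e30 (normr_ge0 _)))// real_normK// num_real.
move/le_trans; apply.
have : (C%:E * \int[P]_w ((Y w - S k w) ^+ 2)%:E <= e3%:E)%E.
  rewrite (le_trans (lee_wpmul2l _ Dk)) ?lee_fin ?(ltW C0)//.
  by rewrite mulrC divfK ?gt_eqF.
rewrite -EFinM mulr1 => H.
rewrite (le_trans (leeD (lexx _) (leeD (lexx _) H)))// -!EFinD lee_fin.
move: mk; rewrite ler_norml => /andP[mk _]; rewrite /e3 in mk *; lra.
Qed.

Let expectation_le : (\int[P]_w (expR (Y w))%:E <= L%:E)%E.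
Proof.
(* The levels [n.+1] are positive, as [truncated_le] demands. *)
pose g n w := (Num.min (expR (Y w)) n.+1%:R)%:E.
have gcvg : (\int[P]_w g n w)%E @[n --> \oo] --> (\int[P]_w (expR (Y w))%:E)%E.
  have -> : (\int[P]_w (expR (Y w))%:E = \int[P]_w (limn (g ^~ w)))%E.
    apply: eq_integral => w _; apply/esym/cvg_lim => //.
    apply: cvg_near_cst; near=> n; rewrite /g; congr EFin; apply/min_idPl.
    rewrite (le_trans (ltW (truncnS_gt (expR (Y w)))))// ler_nat ltnS.
    by near: n; exact: nbhs_infty_ge.
  apply: cvg_monotone_convergence => //.
  - by move=> n; apply/measurable_EFinP; exact: mminY.
  - by move=> n w _; rewrite lee_fin le_min expR_ge0 ler0n.
  - move=> w _ i j ij; rewrite lee_fin le_min !ge_min lexx/=.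
    by rewrite ler_nat ltnS ij orbT.
apply/lee_addgt0Pr => e e0.
rewrite -(cvg_lim _ gcvg)//; apply: lime_le; first by apply/cvg_ex; eexists; exact: gcvg.
by apply: nearW => n; exact: truncated_le.
Unshelve. all: by end_near. Qed.

Let le_expectation : (L%:E <= \int[P]_w (expR (Y w))%:E)%E.
Proof.
apply/lee_addgt0Pr => e e0; pose e4 := e / 4; have e40 : 0 < e4 by rewrite divr_gt0.
(* For large [k] one has [m2 k <= |K| + 1], so at this level the part cut off, at most [m2 k / M],
   costs no more than [e4]. *)
pose M := (`|K| + 1) / e4; have M0 : 0 < M by rewrite divr_gt0// ltr_wpDl.
pose C := M ^+ 2 / e4; have C0 : 0 < C by rewrite divr_gt0// exprn_gt0.
have [k [Dk [mk m2k]]] : exists k, (\int[P]_w ((Y w - S k w) ^+ 2)%:E <= (e4 / C)%:E)%E /\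
    (`|L - m k| <= e4 /\ `|K - m2 k| <= 1).
  have h1 := cvge0_le _ _ _ (divr_gt0 e40 C0) SY.
  have /cvgrPdist_le/(_ _ e40) h2 := mL.
  have /cvgrPdist_le/(_ _ ltr01) h3 := m2K.
  by have [k _ hk] := filterI h1 (filterI h2 h3); exists k; exact: (hk k (leqnn k)).
have := @ge0_integral_le_comb _ _ R P setT (fun w => expR (S k w))
  (fun w => expR (Y w)) (cst 1) (fun w => (Y w - S k w) ^+ 2)
  (fun w => expR (S k w) ^+ 2) e4 C M^-1
  measurableT (mexp _ (mS k)) (mexp _ mY) (measurable_cst _) (mD k)
  (measurable_funX _ (mexp _ (mS k)))
  (fun=> expR_ge0 _) (fun=> expR_ge0 _) (fun=> ler01) (fun=> sqr_ge0 _) (fun=> sqr_ge0 _)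
  (ltW e40) (ltW C0).
rewrite invr_ge0 integral_cst_probability mE m2E => /(_ (ltW M0) _)/wrap[].
  move=> w _; rewrite /= mulr1.
  have h : expR (S k w) <= Num.min (expR (S k w)) M + M^-1 * expR (S k w) ^+ 2.
    have [SM|MS] := leP (expR (S k w)) M.
      by rewrite lerDl mulr_ge0 ?sqr_ge0// invr_ge0 ltW.
    rewrite (@le_trans _ _ (M^-1 * expR (S k w) ^+ 2))//; last by rewrite lerDr ltW.
    rewrite expr2 mulrA -ler_pdivrMr ?expR_gt0// divff ?gt_eqF ?expR_gt0//.
    by rewrite ler_pdivlMl// mulr1 ltW.
  have h2 := min_expR_lipschitz _ M (S k w) (Y w) M0.
  have h3 := amgm_scaled _ M e4 _ e40 (normr_ge0 (S k w - Y w)).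
  rewrite distrC real_normK ?num_real// in h3.
  rewrite distrC in h2.
  have h4 : Num.min (expR (Y w)) M <= expR (Y w) by rewrite ge_min lexx.
  rewrite -/C in h3; lra.
move=> H.
have HC : (C%:E * \int[P]_w ((Y w - S k w) ^+ 2)%:E <= e4%:E)%E.
  rewrite (le_trans (lee_wpmul2l _ Dk)) ?lee_fin ?(ltW C0)//.
  by rewrite mulrC divfK ?gt_eqF.
have HM : (M^-1%:E * (m2 k)%:E <= e4%:E)%E.
  rewrite -EFinM lee_fin mulrC ler_pdivrMr// /M mulrC divfK ?gt_eqF//.
  move: m2k; rewrite ler_norml => /andP[m2k _].
  by have := ler_norm K; lra.
have {}H := le_trans H (leeD (lexx _) (leeD (lexx _) (leeD HC HM))).
rewrite -EFinM mulr1 -!EFinD in H.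
apply: (@le_trans _ _ ((m k)%:E + e4%:E)%E).
  rewrite -EFinD lee_fin; move: mk; rewrite ler_norml => /andP[_]; lra.
rewrite (le_trans (leeD H (lexx _)))// -addeA leeD2l// -EFinD lee_fin /e4; lra.
Qed.

Lemma expectation_expR_limit : (\int[P]_w (expR (Y w))%:E = L%:E)%E.
Proof. by apply/eqP; rewrite eq_le expectation_le le_expectation. Qed.

End exponential_moment_limit.

Lemma bounded_integrable (R : realType) (a b M : R) (g : R -> R) :
  measurable_fun `[a, b] g -> (forall u, u \in `[a, b] -> `|g u| <= M) ->
  lebesgue_measure.-integrable `[a, b] (EFin \o g).
Proof.
move=> mg gM; apply: measurable_bounded_integrable => //.
- by apply: compact_finite_measure; exact: segment_compact.
- exists M; split; first by rewrite num_real.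
  by move=> x Mx u abu /=; rewrite (le_trans _ (ltW Mx))// gM.
Qed.

Lemma bounded_sqr_integrable (R : realType) (a b M : R) (g : R -> R) :
  measurable_fun `[a, b] g -> (forall u, u \in `[a, b] -> `|g u| <= M) ->
  lebesgue_measure.-integrable `[a, b] (EFin \o (fun u => g u ^+ 2)).
Proof.
move=> mg gM; apply: (bounded_integrable _ _ _ (M ^+ 2)); first exact: measurable_funX.
move=> u abu; rewrite normrX.
by rewrite lerXn2r ?nnegrE// ?gM// (le_trans (normr_ge0 _) (gM _ abu)).
Qed.

Section wiener_moment.
Context {R : realType} {d : measure_display} {Omega : measurableType d}.
Variables (P : probability Omega R) (W : R -> Omega -> R).
Hypothesis BM : is_brownian_motion P W.

Lemma wiener_integral_mgf (a b M lam : R) (g : R -> R) (Y : Omega -> R) :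
  0 <= a -> measurable_fun `[a, b] g -> (forall u, u \in `[a, b] -> `|g u| <= M) ->
  wiener_integral P W a b g Y ->
  (\int[P]_w (expR (lam * Y w))%:E
   = (expR (lam ^+ 2 / 2 * Rintegral lebesgue_measure `[a, b] (fun u => g u ^+ 2)))%:E)%E.
Proof.
move=> a0 mg gM [mY [n [s [c [part L2 L2P]]]]].
have s0 k : 0 <= s k 0%N by case: (part k) => ->.
have sS k : forall i, (i < n k)%N -> s k i <= s k i.+1 by case: (part k).
pose v k := \sum_(i < n k) c k i ^+ 2 * (s k i.+1 - s k i).
have vcvg : v @ \oo --> Rintegral lebesgue_measure `[a, b] (fun u => g u ^+ 2).
  apply: (@cvg_integral_sqr _ (measurableTypeR R) R lebesgue_measure `[a, b] g
    (fun k => step_fun (n k) (s k) (c k)) _ v) => //.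
  - by move=> k; exact: measurable_step_fun.
  - rewrite /Rintegral fineK//; apply: integrable_fin_num => //.
    exact: bounded_sqr_integrable gM.
  - by move=> k; apply: integral_sqr_step_fun; case: (part k).
pose m t k := expR (t ^+ 2 / 2 * v k).
have mcvg t : m t @ \oo --> expR (t ^+ 2 / 2 *
    Rintegral lebesgue_measure `[a, b] (fun u => g u ^+ 2)).
  apply: continuous_cvg; first exact: continuous_expR.
  exact: cvgMr.
have mS k := measurable_step_int P W BM (n k) (s k) (c k).
apply: (@expectation_expR_limit _ _ _ P
  (fun k w => lam * step_int W (n k) (s k) (c k) w) (fun w => lam * Y w) _ _
  (m lam) (m (2 * lam)) _ _ _ _ (mcvg lam) (mcvg (2 * lam))).
- by move=> k; exact: measurable_funM.
- exact: measurable_funM.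
- by move=> k; exact: (step_int_mgf P W BM (n k) (s k) (c k) lam (s0 k) (sS k)).
- move=> k; rewrite /m /v -(step_int_mgf P W BM (n k) (s k) (c k) (2 * lam) (s0 k) (sS k)).
  by apply: eq_integral => w _; rewrite -expRM_natl mulrA.
- have -> : (fun k => \int[P]_w ((lam * Y w - lam * step_int W (n k) (s k) (c k) w) ^+ 2)%:E)%E
     = (fun k => (lam ^+ 2)%:E * \int[P]_w ((Y w - step_int W (n k) (s k) (c k) w) ^+ 2)%:E)%E.
    apply/funext => k; rewrite -ge0_integralZl_EFin ?sqr_ge0//.
    + by apply: eq_integral => w _; rewrite -mulrBr exprMn EFinM.
    + by move=> w _; rewrite lee_fin sqr_ge0.
    + by apply/measurable_EFinP; apply: measurable_funX; exact: measurable_funB.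
  by rewrite -(mule0 (lam ^+ 2)%:E); apply: cvgeZl.
Qed.

End wiener_moment.

(** * Existence of Wiener integrals *)

Lemma limn_einf_le (R : realType) (u : nat -> \bar R) (c : \bar R) :
  (forall n, u n <= c)%E -> (limn_einf u <= c)%E.
Proof.
move=> uc; rewrite limn_einf_lim; apply: lime_le; first exact: is_cvg_einfs.
apply: nearW => n; apply: le_trans (uc n).
by apply: ereal_inf_lbound; exists n => /=.
Qed.

Lemma summable_increments_cvg (R : realType) (u : nat -> R) :
  (\sum_(0 <= k <oo) `|u k.+1 - u k|%:E < +oo)%E -> cvgn u.
Proof.
set s := (\sum_(0 <= k <oo) _)%E => soo.
have s0 : (0 <= s)%E by apply: nneseries_ge0 => n _ _; rewrite lee_fin.
have sfin : s \is a fin_num by rewrite ge0_fin_numE.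
have tcvg : cvgn (series (telescope u)).
  apply: normed_cvg; apply: nondecreasing_is_cvgn.
    by apply/nondecreasing_seqP => n; rewrite /= seriesSr lerDl.
  exists (fine s) => _ [n _ <-]; rewrite -lee_fin fineK// /= /series/= -sumEFin.
  by apply: nneseries_lim_ge => k _ _; rewrite lee_fin.
have -> : u = (fun n => u 0%N + series (telescope u) n).
  by apply/funext => n; exact: eq_sum_telescope.
by apply: is_cvgD => //; exact: is_cvg_cst.
Qed.

Lemma measurable_fun_limn_einf d (T : measurableType d) (R : realType) (D : set T)
    (f : nat -> T -> \bar R) : (forall n, measurable_fun D (f n)) ->
  measurable_fun D (fun x => limn_einf (f ^~ x)).
Proof.
move=> mf.
have -> : (fun x => limn_einf (f ^~ x)) =
    (fun x => - limn_esup ((fun n x => - f n x) ^~ x))%E.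
  apply/funext => x; rewrite -limn_einfN; congr limn_einf.
  by apply/funext => n /=; rewrite oppeK.
apply: measurableT_comp => //; apply: measurable_fun_limn_esup => n.
exact: measurableT_comp.
Qed.

(** * Completeness of L2 along a fast Cauchy sequence *)

Section L2_completeness.
Context {R : realType} {d : measure_display} {Omega : measurableType d}.
Variables (P : probability Omega R) (S : nat -> Omega -> R) (C : R).
Hypothesis mS : forall k, measurable_fun setT (S k).
(** A geometric rate, so that the increments, of order [e k] in mean, are summable; the exponent
    [k + 1] is that of the halving series which sums them. *)
Let e k : R := (2 ^ (k + 1))%:R^-1.
Hypothesis cauchyS : forall k j, (k <= j)%N ->
  (\int[P]_w ((S j w - S k w) ^+ 2)%:E <= (C * e k ^+ 2)%:E)%E.

Let e0 k : 0 < e k. Proof. by rewrite invr_gt0 ltr0n expn_gt0. Qed.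

Let mdiff j k : measurable_fun setT (fun w => S j w - S k w).
Proof. exact: measurable_funB. Qed.

(** By [|x| <= e + x ^+ 2 / e] with [e] equal to [e k], a squared distance of order [e k ^+ 2]
    becomes a mean distance of order [e k]. *)
Let increment_le k : (\int[P]_w `|S k.+1 w - S k w|%:E <= ((1 + C) / (2 ^ (k + 1))%:R)%:E)%E.
Proof.
have := @ge0_integral_le_comb _ _ R P setT (fun w => `|S k.+1 w - S k w|) (cst 0)
  (cst 1) (fun w => (S k.+1 w - S k w) ^+ 2) (cst 0) (e k) (e k)^-1 0 measurableT
  (measurableT_comp (@normr_measurable _ _) (mdiff _ _)) (measurable_cst _)
  (measurable_cst _) (measurable_funX _ (mdiff _ _)) (measurable_cst _)
  (fun=> normr_ge0 _) (fun=> lexx _) (fun=> ler01) (fun=> sqr_ge0 _) (fun=> lexx _)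
  (ltW (e0 k)).
rewrite invr_ge0 !integral_cst_probability mul0e adde0 add0e.
move=> /(_ (ltW (e0 k)) (lexx _) _)/wrap[].
  move=> w _; rewrite /= mulr1 mulr0 addr0 add0r.
  have := amgm_scaled _ 1 _ _ (e0 k) (normr_ge0 (S k.+1 w - S k w)).
  by rewrite mul1r expr1n mul1r real_normK// num_real.
move/le_trans; apply.
have h : ((e k)^-1%:E * \int[P]_w ((S k.+1 w - S k w) ^+ 2)%:E <= (C * e k)%:E)%E.
  rewrite (le_trans (lee_wpmul2l _ (cauchyS _ _ (leqnSn k))))// ?lee_fin ?invr_ge0 ?(ltW (e0 k))//.
  rewrite (_ : (e k)^-1 * (C * e k ^+ 2) = C * e k)//.
  by field; rewrite gt_eqF// e0.
rewrite (le_trans (leeD (lexx _) h))// -EFinM -EFinD lee_fin mulr1 -/(e k).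
by rewrite mulrDl mul1r.
Qed.

(** The upper limit is measurable whether or not the sequence converges; [fine] replaces infinite
    values by 0, which by [ae_cvg] matters only on a null set. *)
Let Y w : R := fine (limn_esup (fun k => (S k w)%:E)).

Let mY : measurable_fun setT Y.
Proof.
apply: (@measurableT_comp _ _ _ _ _ _ fine).
  exact: fine_measurable.
by apply: measurable_fun_limn_esup => k; exact/measurable_EFinP.
Qed.

Let ae_cvg : \forall w \ae P, (S ^~ w) @ \oo --> Y w.
Proof.
pose G w := (\sum_(0 <= k <oo) `|S k.+1 w - S k w|%:E)%E.
have mabs k : measurable_fun setT (fun w => `|S k.+1 w - S k w|%:E).
  by apply/measurable_EFinP; exact: (measurableT_comp (@normr_measurable _ _) (mdiff _ _)).
have G0 w : (0 <= G w)%E by apply: nneseries_ge0 => n _ _; rewrite lee_fin.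
have Gint : P.-integrable setT G.
  apply/integrableP; split.
    by apply: ge0_emeasurable_sum => [k w _ _|k _]; rewrite ?lee_fin.
  under eq_integral do rewrite gee0_abs//.
  rewrite integral_nneseries//.
  apply: (@le_lt_trans _ _ (\sum_(0 <= k <oo) ((1 + C) / (2 ^ (k + 1))%:R)%:E)%E).
    by apply: lee_nneseries => [k _ _|k _]; [exact: integral_ge0|exact: increment_le].
  have := @cvg_geometric_eseries_half R (1 + C) 0; move/cvg_lim => -> //.
  by rewrite ltry.
have := integrable_ae measurableT Gint; apply: filterS => w /(_ I) Gw.
have : cvgn (S ^~ w).
  by apply: summable_increments_cvg; rewrite -ge0_fin_numE//; exact: G0.
move=> cS; rewrite /Y is_cvg_limn_esupE.
  by rewrite EFin_lim.
by apply/cvg_ex; exists (limn (S ^~ w))%:E; apply: cvg_EFin; [exact: nearW|exact: cS].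
Qed.

(** Fatou's lemma along the differences [S (j + k) - S k]: the bound from [cauchyS] holds for every
    [j], hence for the almost sure limit. *)
Lemma L2_complete : exists2 Y : Omega -> R, measurable_fun setT Y &
  forall k, (\int[P]_w ((Y w - S k w) ^+ 2)%:E <= (C * e k ^+ 2)%:E)%E.
Proof.
exists Y => // k.
have mf j : measurable_fun setT (fun w => ((S (j + k)%N w - S k w) ^+ 2)%:E).
  by apply/measurable_EFinP; exact: measurable_funX.
have := @fatou _ _ _ P setT measurableT _ mf
  (fun j w _ => sqr_ge0 (S (j + k)%N w - S k w)).
have -> : (\int[P]_w limn_einf ((fun j w => ((S (j + k)%N w - S k w) ^+ 2)%:E) ^~ w)
    = \int[P]_w ((Y w - S k w) ^+ 2)%:E)%E.
  apply: ae_eq_integral => //.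
  - exact: measurable_fun_limn_einf.
  - by apply/measurable_EFinP; apply: measurable_funX; exact: measurable_funB.
  - apply: filterS ae_cvg => w Yw _.
    have Yk : (fun j => S (j + k)%N w - S k w) @ \oo --> Y w - S k w.
      by apply: cvgB; [rewrite (cvg_shiftn k (S ^~ w))|exact: cvg_cst].
    apply: (@cvg_limn_einf_sup _ _ _ _).1.
    apply: cvg_EFin; first exact: nearW.
    exact: (cvgM Yk Yk).
move=> /le_trans; apply; apply: limn_einf_le => j.
by apply: cauchyS; rewrite leq_addl.
Qed.

End L2_completeness.

(** * Dyadic partitions *)

Definition dyadic_grid {R : realType} (a b : R) (k i : nat) : R :=
  a + (b - a) * (i%:R / (2 ^ k)%:R).

Section dyadic.
Context {R : realType}.
Variables (a b : R).
Hypothesis ab : a <= b.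
Local Notation grid := (dyadic_grid a b).

Lemma dyadic_grid0 k : grid k 0 = a.
Proof. by rewrite /dyadic_grid mul0r mulr0 addr0. Qed.

Lemma dyadic_grid_last k : grid k (2 ^ k) = b.
Proof. by rewrite /dyadic_grid divff ?pnatr_eq0 ?expn_eq0// mulr1 addrC subrK. Qed.

Lemma dyadic_grid_le k i j : (i <= j)%N -> grid k i <= grid k j.
Proof.
move=> ij; rewrite lerD2l ler_wpM2l ?subr_ge0// ler_wpM2r ?invr_ge0 ?ler0n//.
by rewrite ler_nat.
Qed.

Lemma dyadic_grid_refine k j i : grid (k + j) (i * 2 ^ j) = grid k i.
Proof.
rewrite /dyadic_grid; congr (_ + _ * _); rewrite expnD !natrM.
by field; rewrite !pnatr_eq0 !expn_eq0.
Qed.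

(** The coarse cell [i] splits into the fine cells [l] with [l %/ 2 ^ j = i], over which the
    increments of [w] telescope. Additive levels give the grids [k] and [k'] the common refinement
    [k + k']. *)
Lemma sum_increments_refine (w : R -> R) (c : nat -> R) k j :
  \sum_(i < 2 ^ k) c i * (w (grid k i.+1) - w (grid k i))
  = \sum_(i < 2 ^ (k + j)) c (i %/ 2 ^ j)%N
      * (w (grid (k + j) i.+1) - w (grid (k + j) i)).
Proof.
rewrite -!(big_mkord xpredT (fun i => c i * (w (grid k i.+1) - w (grid k i)))).
rewrite -(big_mkord xpredT (fun i => c (i %/ 2 ^ j)%N
      * (w (grid (k + j) i.+1) - w (grid (k + j) i)))).
rewrite expnD big_nat_mul; apply: eq_bigr => i _.
rewrite (eq_big_nat _ _ (F2 := fun l =>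
    c i * (w (grid (k + j) l.+1) - w (grid (k + j) l)))); last first.
  move=> l /andP[il li]; congr (c _ * _); apply/eqP.
  by rewrite eqn_leq -ltnS ltn_divLR ?expn_gt0// li/= leq_divRL ?expn_gt0.
rewrite -mulr_sumr (telescope_sumr (fun l => w (grid (k + j) l))); last first.
  by rewrite leq_mul2r leqnSn orbT.
by rewrite !dyadic_grid_refine.
Qed.

(* The indicator of [[x, y[] at [u] is the increment over [x, y] of the path
   [s |-> (u < s)]: [step_fun] becomes a sum of the same form as [step_int], and
   [sum_increments_refine] applies to both. *)
Lemma step_fun_increments n (s c : nat -> R) u :
  (forall i, (i < n)%N -> s i <= s i.+1) ->
  step_fun n s c u = \sum_(i < n) c i * ((u < s i.+1)%R%:R - (u < s i)%R%:R).
Proof.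
move=> sS; apply: eq_bigr => i _; congr (_ * _).
rewrite indicE mem_setE in_itv/=; have := sS i (ltn_ord i).
case: (leP (s i) u) => su; case: (leP (s i.+1) u) => us ss; rewrite ?subr0 ?subrr//=.
by have := lt_le_trans su (le_trans ss us); rewrite ltxx.
Qed.

Lemma step_fun_at n (s c : nat -> R) u i : (forall i, (i < n)%N -> s i <= s i.+1) ->
  (i < n)%N -> s i <= u < s i.+1 -> step_fun n s c u = c i.
Proof.
move=> sS ni /andP[iu ui]; rewrite /step_fun (bigD1 (Ordinal ni))//= indicE mem_set/=.
  rewrite mulr1 big1 ?addr0// => j /eqP ji; rewrite indicE memNset ?mulr0//=.
  rewrite in_itv/= => /andP[ju uj].
  have [ij|ij|/esym ij] := ltngtP i j; last by apply: ji; exact: val_inj.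
    have := partition_le n s sS i.+1 j; rewrite ij ltnW//= => /(_ isT) h.
    by have := lt_le_trans ui (le_trans h ju); rewrite ltxx.
  have := partition_le n s sS j.+1 i; rewrite ij ltnW//= => /(_ isT) h.
  by have := lt_le_trans uj (le_trans h iu); rewrite ltxx.
by rewrite in_itv/= iu.
Qed.

Lemma dyadic_grid_index k u : a <= u < b ->
  exists2 i, (i < 2 ^ k)%N & grid k i <= u < grid k i.+1.
Proof.
move=> /andP[au ub].
have ba : 0 < b - a by rewrite subr_gt0 (le_lt_trans au).
have p0 : 0 < (2 ^ k)%:R :> R by rewrite ltr0n expn_gt0.
pose x := (u - a) / (b - a) * (2 ^ k)%:R.
have x0 : 0 <= x by rewrite mulr_ge0// divr_ge0// ?subr_ge0// ltW.
have /andP[ix xi] := truncn_itv x0.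
have uE : u = a + (b - a) * (x / (2 ^ k)%:R).
  by rewrite /x; field; rewrite !gt_eqF.
exists (Num.truncn x).
  rewrite -(ltr_nat R) (le_lt_trans ix)// /x gtr_pMl// ltr_pdivrMr// mul1r.
  by rewrite ltrD2r.
rewrite /dyadic_grid uE lerD2l ltrD2l ler_pM2l// ltr_pM2l//.
by rewrite ler_pM2r ?invr_gt0// ltr_pM2r ?invr_gt0// ix.
Qed.

Lemma dyadic_grid_dist k u i : grid k i <= u < grid k i.+1 ->
  `|u - grid k i| <= (b - a) * 2^-1 ^+ k.
Proof.
move=> /andP[iu ui]; rewrite ger0_norm ?subr_ge0//.
rewrite lerBlDl (le_trans (ltW ui))// /dyadic_grid -addrA lerD2l -mulrDr.
rewrite ler_wpM2l ?subr_ge0// (_ : 2^-1 ^+ k = 1 / (2 ^ k)%:R); last first.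
  by rewrite exprVn natrX mul1r.
by rewrite -mulrDl natr1.
Qed.

End dyadic.

(** A continuous approximant of a function with values in [0, 1] may leave that interval. Projecting
    it back keeps continuity and does not increase the error. *)
Definition clip {R : realType} (x : R) : R := Num.min (Num.max x 0) 1.

Section clip.
Context {R : realType}.
Implicit Types x y : R.

Lemma clip_itv x : 0 <= clip x <= 1.
Proof. by rewrite /clip le_min le_max lexx orbT ler01 ge_min lexx orbT. Qed.

Lemma clip_id x : 0 <= x <= 1 -> clip x = x.
Proof.
by move=> /andP[x0 x1]; rewrite /clip (max_idPl x0) (min_idPl x1).
Qed.

Lemma clip_lipschitz x y : `|clip x - clip y| <= `|x - y|.
Proof.
wlog xy : x y / x <= y => [H|].
  have [/H//|/ltW/H] := leP x y.
  by rewrite distrC [leRHS]distrC.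
have : clip x <= clip y.
  rewrite /clip le_min !ge_min lexx orbT andbT; apply/orP; left.
  by rewrite ge_max !le_max xy lexx orbT.
move=> cxy; rewrite ler0_norm ?subr_le0// ler0_norm ?subr_le0// !opprB.
rewrite /clip; case: (leP x 0) => x0; case: (leP y 0) => y0;
  rewrite ?(min_idPl ler01);
  do ?[case: (leP x 1) => x1]; do ?[case: (leP y 1) => y1]; lra.
Qed.

Lemma continuous_clip (h : R -> R) : continuous h -> continuous (clip \o h).
Proof.
move=> ch u; apply/cvgrPdist_le => e e0.
have /cvgrPdist_le/(_ e e0) := ch u.
by apply: filterS => v; apply: le_trans; exact: clip_lipschitz.
Qed.

End clip.

Section dyadic_approximation.
Context {R : realType}.
Variables (a b : R).
Hypothesis ab : a <= b.
Local Notation grid := (dyadic_grid a b).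

Let step k (h : R -> R) : R -> R := step_fun (2 ^ k) (grid k) (fun i => h (grid k i)).

Let gridS k i : (i < 2 ^ k)%N -> grid k i <= grid k i.+1.
Proof. by move=> _; apply: dyadic_grid_le. Qed.

Lemma dyadic_step_cvg (h : R -> R) : continuous h -> (forall u, 0 <= h u <= 1) ->
  (fun k => \int[lebesgue_measure]_(u in `[a, b]) ((h u - step k h u) ^+ 2)%:E)%E
    @ \oo --> 0%E.
Proof.
move=> ch h01.
have mh : measurable_fun setT h by exact: continuous_measurable_fun.
have mf D k : measurable_fun D (fun u => ((h u - step k h u) ^+ 2)%:E).
  apply/measurable_EFinP; apply: measurable_funX; apply: measurable_funB.
    exact: measurable_funTS.
  exact: measurable_step_fun.
(* The endpoint [b] lies in no half-open cell, so the step function is 0 there; dropping this null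
   point makes [stepE] available everywhere. *)
have -> : (fun k => \int[lebesgue_measure]_(u in `[a, b]) ((h u - step k h u) ^+ 2)%:E)%E
  = (fun k => \int[lebesgue_measure]_(u in `[a, b[) ((h u - step k h u) ^+ 2)%:E)%E.
  by apply/funext => k; rewrite integral_itv_bndo_bndc.
have stepE u k : a <= u < b -> exists2 v, `|u - v| <= (b - a) * 2^-1 ^+ k & step k h u = h v.
  move=> uab; have [i ik iu] := dyadic_grid_index _ _ ab k u uab.
  exists (grid k i); first exact: dyadic_grid_dist.
  exact: (step_fun_at _ _ (fun i => h (grid k i)) u i (gridS k)).
have cst_int : lebesgue_measure.-integrable `[a, b[ (fun=> 1%:E : \bar R).
  apply/integrableP; split => //.
  under eq_integral do rewrite /= normr1.
  rewrite integral_cst//= mul1e lebesgue_measure_itv/=.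
  by case: ifP => _; rewrite -?EFinB ltry.
rewrite -(integral0 lebesgue_measure (`[a, b[%classic : set R)).
have [] := @dominated_convergence _ _ R lebesgue_measure `[a, b[%classic
  (measurable_itv _) (fun k u => ((h u - step k h u) ^+ 2)%:E) (cst 0%E) (fun=> 1%:E)
  (mf _) (measurable_cst _) _ cst_int _ => //.
- apply: aeW => u /=; rewrite in_itv/= => uab; apply: cvg_EFin; first exact: nearW.
  rewrite [X in X @ _](_ : _ = (fun k => (h u - step k h u) * (h u - step k h u))); last first.
    by apply/funext => k /=; rewrite expr2.
  suff H : (fun k => h u - step k h u) @ \oo --> (0 : R).
    by rewrite -(mulr0 (0 : R)); exact: (cvgM H H).
  apply/cvgr0Pnorm_le => e e0.
  have /cvgrPdist_le/(_ e e0)/nbhs_ballP[r /= r0 hr] := ch u.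
  have half1 : `|2^-1 : R| < 1 by rewrite ger0_norm ?invr_ge0// invf_lt1// ltr1n.
  have /cvgr0Pnorm_lt/(_ r r0) := cvg_geometric (b - a) half1.
  apply: filterS => k; rewrite /geometric/= => kr.
  have [v uv ->] := stepE u k uab; apply: hr; rewrite /ball/=.
  by rewrite (le_lt_trans uv)// (le_lt_trans (ler_norm _)).
- apply: aeW => u k /=; rewrite in_itv/= => uab.
  have [v _ ->] := stepE u k uab; rewrite lee_fin normrX.
  rewrite expr_le1// ler_norml.
  by have := h01 u; have := h01 v; move=> /andP[? ?] /andP[? ?]; apply/andP; split; lra.
Qed.

End dyadic_approximation.

Section wiener_existence.
Context {R : realType}.
Variables (a b : R).
Hypothesis ab : a <= b.
Local Notation grid := (dyadic_grid a b).

Let gridS k i : (i < 2 ^ k)%N -> grid k i <= grid k i.+1.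
Proof. by move=> _; apply: dyadic_grid_le. Qed.

Let two0 : (0 <= 2%:E :> \bar R)%E. Proof. by rewrite lee_fin. Qed.

(** Continuous functions are dense in L1. As [g] and the clipped approximant lie in [0, 1], the
    square of their difference is at most its absolute value, so density in L1 is enough for the L2
    norm. *)
Lemma dyadic_L2_approx (g : R -> R) (e : R) : measurable_fun `[a, b] g ->
  (forall u, u \in `[a, b] -> 0 <= g u <= 1) -> 0 < e ->
  exists k c, (\int[lebesgue_measure]_(u in `[a, b])
    ((g u - step_fun (2 ^ k) (grid k) c u) ^+ 2)%:E <= e%:E)%E.
Proof.
move=> mg g01 e0; have e40 : 0 < e / 4 by rewrite divr_gt0.
have gint : lebesgue_measure.-integrable `[a, b] (EFin \o g).
  by apply: (bounded_integrable _ _ _ 1) => // u /g01 /andP[? ?]; rewrite ger0_norm.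
have [|h_ [hc _ hcvg]] := approximation_continuous_integrable (measurable_itv `[a, b]) _ gint.
  by apply: compact_finite_measure; exact: segment_compact.
have [n _ /(_ n (leqnn n)) hn] := cvge0_le _ _ _ e40 hcvg.
pose h := clip \o h_ n.
have ch : continuous h by apply: continuous_clip.
have h01 u : 0 <= h u <= 1 by exact: clip_itv.
have [k _ /(_ k (leqnn k)) kn] := cvge0_le _ _ _ e40 (dyadic_step_cvg a b ab h ch h01).
exists k, (fun i => h (grid k i)).
set phi := step_fun _ _ _ in kn *.
have mphi : measurable_fun `[a, b] phi by exact: measurable_step_fun.
have mh : measurable_fun `[a, b] h.
  by apply: measurable_funTS; exact: continuous_measurable_fun.
have mhn : measurable_fun `[a, b] (h_ n).
  by apply: measurable_funTS; exact: continuous_measurable_fun.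
have := @ge0_integral_le_comb _ _ R lebesgue_measure `[a, b]%classic
  (fun u => (g u - phi u) ^+ 2) (cst 0) (fun u => `|g u - h_ n u|)
  (fun u => (h u - phi u) ^+ 2) (cst 0) 2 2 0 (measurable_itv _)
  (measurable_funX _ (measurable_funB mg mphi)) (measurable_cst _)
  (measurableT_comp (@normr_measurable _ _) (measurable_funB mg mhn))
  (measurable_funX _ (measurable_funB mh mphi)) (measurable_cst _)
  (fun=> sqr_ge0 _) (fun=> lexx _) (fun=> normr_ge0 _) (fun=> sqr_ge0 _)
  (fun=> lexx _) (ler0n R 2) (ler0n R 2) (lexx _).
rewrite integral0 mul0e adde0 add0e => /(_ _)/wrap[].
  move=> u abu; rewrite /= mulr0 addr0 add0r.
  have g1 := g01 _ abu; have h1 := h01 u.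
  have gh : (g u - h u) ^+ 2 <= `|g u - h_ n u|.
    apply: le_trans (_ : `|g u - h u| <= _); last first.
      by rewrite -{1}(clip_id _ g1); exact: clip_lipschitz.
    rewrite -real_normK ?num_real// expr2 ler_piMl// ler_norml.
    by move: g1 h1 => /andP[? ?] /andP[? ?]; apply/andP; split; lra.
  (* Parallelogram identity: this yields [(g u - phi u) ^+ 2 <= 2 * (g u - h u) ^+ 2 + 2 * (h u -
     phi u) ^+ 2]. *)
  have : 0 <= (g u - 2 * h u + phi u) ^+ 2 by exact: sqr_ge0.
  nra.
move/le_trans; apply.
have := leeD (lee_wpmul2l two0 hn)
  (lee_wpmul2l two0 kn).
move/le_trans; apply; rewrite -!EFinM -EFinD lee_fin; lra.
Qed.

Context {d : measure_display} {Omega : measurableType d}.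
Variables (P : probability Omega R) (W : R -> Omega -> R).
Hypothesis BM : is_brownian_motion P W.
Hypothesis a0 : 0 <= a.

(** On the common refinement the two differences are a step integral and a step function with the
    same coefficients, so the bound for a single step integral applies. *)
Lemma dyadic_step_int_dist k k' (c c' : nat -> R) :
  (\int[P]_w ((step_int W (2 ^ k) (grid k) c w
               - step_int W (2 ^ k') (grid k') c' w) ^+ 2)%:E
   <= 8%:E * \int[lebesgue_measure]_(u in `[a, b])
        ((step_fun (2 ^ k) (grid k) c u
          - step_fun (2 ^ k') (grid k') c' u) ^+ 2)%:E)%E.
Proof.
pose c'' i := c (i %/ 2 ^ k')%N - c' (i %/ 2 ^ k)%N.
have diff (w : R -> R) :
    \sum_(i < 2 ^ k) c i * (w (grid k i.+1) - w (grid k i))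
    - \sum_(i < 2 ^ k') c' i * (w (grid k' i.+1) - w (grid k' i))
    = \sum_(i < 2 ^ (k + k')) c'' i * (w (grid (k + k') i.+1) - w (grid (k + k') i)).
  rewrite (sum_increments_refine a b w c k k') (sum_increments_refine a b w c' k' k).
  by rewrite (addnC k' k) -sumrB; apply: eq_bigr => i _; rewrite -mulrBl.
have intE w : step_int W (2 ^ k) (grid k) c w - step_int W (2 ^ k') (grid k') c' w
    = step_int W (2 ^ (k + k')) (grid (k + k')) c'' w := diff (W ^~ w).
have funE u : step_fun (2 ^ k) (grid k) c u - step_fun (2 ^ k') (grid k') c' u
    = step_fun (2 ^ (k + k')) (grid (k + k')) c'' u.
  rewrite !step_fun_increments//; try exact: gridS.
  exact: (diff (fun s => (u < s)%R%:R)).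
under eq_integral do rewrite intE.
under [in leRHS]eq_integral do rewrite funE.
rewrite (integral_sqr_step_fun _ _ _ a b (dyadic_grid0 _ _ _) (dyadic_grid_last _ _ _) (gridS _)).
rewrite -EFinM; apply: (step_int_sqr_le P W BM); first by rewrite dyadic_grid0.
exact: gridS.
Qed.

Lemma wiener_integral_exists (g : R -> R) : measurable_fun `[a, b] g ->
  (forall u, u \in `[a, b] -> 0 <= g u <= 1) ->
  exists Y, wiener_integral P W a b g Y.
Proof.
move=> mg g01.
pose e k : R := (2 ^ (k + 1))%:R^-1.
have e0 k : 0 < e k by rewrite invr_gt0 ltr0n expn_gt0.
have /choice[k /choice[c gkc]] j : exists k c, (\int[lebesgue_measure]_(u in `[a, b])
    ((g u - step_fun (2 ^ k) (grid k) c u) ^+ 2)%:E <= (e j ^+ 2)%:E)%E.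
  by apply: dyadic_L2_approx => //; rewrite exprn_gt0.
pose S j := step_int W (2 ^ k j) (grid (k j)) (c j).
pose phi j := step_fun (2 ^ k j) (grid (k j)) (c j).
have mphi j : measurable_fun `[a, b] (phi j) by exact: measurable_step_fun.
have mS j : measurable_fun setT (S j) by exact: (measurable_step_int P W BM).
have cauchy j l : (j <= l)%N ->
    (\int[P]_w ((S l w - S j w) ^+ 2)%:E <= (32 * e j ^+ 2)%:E)%E.
  move=> jl; apply: le_trans (dyadic_step_int_dist _ _ _ _) _; rewrite -/(phi l) -/(phi j).
  (* The 8 is the constant of [dyadic_step_int_dist]; the 4 comes from [2 * e l ^+ 2 + 2 * e j ^+ 2]
     with [e l <= e j]. *)
  rewrite (_ : 32 = 8 * 4 :> R); last by rewrite -natrM.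
  rewrite -mulrA EFinM lee_pmul2l// ?lte_fin//.
  have := @ge0_integral_le_comb _ _ R lebesgue_measure `[a, b]%classic
    (fun u => (phi l u - phi j u) ^+ 2) (cst 0) (fun u => (g u - phi l u) ^+ 2)
    (fun u => (g u - phi j u) ^+ 2) (cst 0) 2 2 0 (measurable_itv _)
    (measurable_funX _ (measurable_funB (mphi l) (mphi j))) (measurable_cst _)
    (measurable_funX _ (measurable_funB mg (mphi l)))
    (measurable_funX _ (measurable_funB mg (mphi j))) (measurable_cst _)
    (fun=> sqr_ge0 _) (fun=> lexx _) (fun=> sqr_ge0 _) (fun=> sqr_ge0 _)
    (fun=> lexx _) (ler0n R 2) (ler0n R 2) (lexx _).
  rewrite integral0 mul0e adde0 add0e => /(_ _)/wrap[].
    move=> u _; rewrite /= mulr0 addr0 add0r.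
    have : 0 <= (2 * g u - phi l u - phi j u) ^+ 2 by exact: sqr_ge0.
    nra.
  move/le_trans; apply.
  have := leeD (lee_wpmul2l two0 (gkc l))
    (lee_wpmul2l two0 (gkc j)).
  move/le_trans; apply; rewrite -!EFinM -EFinD lee_fin.
  have : e l ^+ 2 <= e j ^+ 2.
    rewrite lerXn2r ?nnegrE ?(ltW (e0 _))// lef_pV2 ?posrE ?ltr0n ?expn_gt0//.
    by rewrite ler_nat leq_exp2l// leq_add2r.
  lra.
have e2cvg (C : R) : (fun j => (C * e j ^+ 2)%:E) @ \oo --> 0%E.
  apply: cvg_EFin; first exact: nearW.
  have q1 : `|4^-1 : R| < 1 by rewrite ger0_norm ?invr_ge0// invf_lt1// ltr1n.
  rewrite [X in X @ _ --> _](_ : _ = geometric (C / 4) 4^-1); first exact: cvg_geometric.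
  apply/funext => j; rewrite /geometric /= /e -mulrA -exprS.
  rewrite (_ : 4^-1 = 2^-1 ^+ 2 :> R); last by rewrite exprVn -natrX.
  by rewrite natrX -exprVn -!exprM addn1 mulnC.
have [Y mY YS] := L2_complete P S 32 mS cauchy.
exists Y; split => //; exists (fun j => 2 ^ k j)%N, (fun j => grid (k j)), c; split.
- move=> j; split; [exact: dyadic_grid0|exact: dyadic_grid_last|exact: gridS].
- apply: (squeeze_cvge _ (cvg_cst 0%E) (e2cvg 1)).
  by apply: nearW => j; rewrite mul1r gkc integral_ge0// => u _; rewrite lee_fin sqr_ge0.
- apply: (squeeze_cvge _ (cvg_cst 0%E) (e2cvg 32)).
  by apply: nearW => j; rewrite YS integral_ge0// => u _; rewrite lee_fin sqr_ge0.
Qed.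

End wiener_existence.

(** * The control problem *)

Lemma measurable_inv_pos d (T : measurableType d) (R : realType) (D : set T)
    (f : T -> R) : (forall x, D x -> 0 < f x) ->
  measurable_fun D f -> measurable_fun D (fun x => (f x)^-1).
Proof.
move=> f0 mf; apply: (eq_measurable_fun (fun x => f x `^ (-1))).
  by move=> x /set_mem Dx; rewrite powR_inv1// ltW// f0.
exact: (measurableT_comp (measurable_powR (-1)) mf).
Qed.

(* Cauchy-Schwarz for [p1 + p2 + q = 1], with equality when
   [th1 p1 = th2 p2 = dl/2 q]. *)
Lemma retention_cost_ge (R : realType) (dl th1 th2 p1 p2 : R) :
  0 < dl -> 0 < th1 -> 0 < th2 ->
  dl * th1 * th2 / (dl * th1 + dl * th2 + 2 * th1 * th2)
  <= th1 * p1 ^+ 2 + th2 * p2 ^+ 2 + dl / 2 * (1 - p1 - p2) ^+ 2.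
Proof.
move=> dl0 h1 h2.
have a1 : 0 < dl * th1 by rewrite mulr_gt0.
have a2 : 0 < dl * th2 by rewrite mulr_gt0.
have a3 : 0 < th1 * th2 by rewrite mulr_gt0.
set D := _ + _ + _; have D0 : 0 < D by rewrite /D; lra.
rewrite ler_pdivrMr// -subr_ge0.
(* Lagrange's identity for the weights [th1], [th2] and [dl / 2]: each pair contributes a square,
   multiplied by twice the third weight. *)
have -> : (th1 * p1 ^+ 2 + th2 * p2 ^+ 2 + dl / 2 * (1 - p1 - p2) ^+ 2) * D
    - dl * th1 * th2
  = dl * (th1 * p1 - th2 * p2) ^+ 2
    + 2 * th2 * (th1 * p1 - dl / 2 * (1 - p1 - p2)) ^+ 2
    + 2 * th1 * (th2 * p2 - dl / 2 * (1 - p1 - p2)) ^+ 2.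
  by rewrite /D; field.
by rewrite !addr_ge0// mulr_ge0 ?sqr_ge0//; lra.
Qed.

Section real_integrable.
Context d (T : measurableType d) (R : realType).
Variables (m : {measure set T -> \bar R}) (D : set T).
Hypothesis mD : measurable D.

Lemma integrable_scaler (k : R) (f : T -> R) : m.-integrable D (EFin \o f) ->
  m.-integrable D (EFin \o (fun x => k * f x)).
Proof.
move=> fi; rewrite (_ : EFin \o _ = fun x => (k%:E * (EFin \o f) x)%E)//.
exact: integrableZl.
Qed.

Lemma integrable_addr (f g : T -> R) : m.-integrable D (EFin \o f) ->
  m.-integrable D (EFin \o g) -> m.-integrable D (EFin \o (fun x => f x + g x)).
Proof.
move=> fi gi; rewrite (_ : EFin \o _ = fun x => ((EFin \o f) x + (EFin \o g) x)%E)//.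
exact: integrableD.
Qed.

End real_integrable.

Section control.
Context {R : realType} {d : measure_display} {Omega : measurableType d}.
Variables (P : probability Omega R) (W : R -> Omega -> R).
Variables (T c mu sigma delta0 : R) (theta1 theta2 : R -> R).
Hypothesis BM : is_brownian_motion P W.
Hypothesis delta00 : 0 < delta0.
Hypothesis adm1 : admissible_premium T theta1.
Hypothesis adm2 : admissible_premium T theta2.

Let drift (p1 p2 : R -> R) s :=
  c - mu - theta1 s * sigma ^+ 2 * p1 s ^+ 2 - theta2 s * sigma ^+ 2 * p2 s ^+ 2.
Let retention (p1 p2 : R -> R) s := 1 - p1 s - p2 s.
(** The drift enters the utility through the factor [- delta0]; the second term is the exponent rate
    of the moment generating function at [lam = delta0 * sigma]. *)
Let running_cost (p1 p2 : R -> R) s :=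
  - delta0 * drift p1 p2 s + (delta0 * sigma) ^+ 2 / 2 * retention p1 p2 s ^+ 2.

Let subT t : 0 <= t -> (`[t, T] `<=` (`[0, T] : set R)).
Proof. by move=> t0; apply: subset_itvr; rewrite bnd_simp. Qed.

Let measurable_on t (f : R -> R) : 0 <= t ->
  measurable_fun `[0, T] f -> measurable_fun `[t, T] f.
Proof. by move=> t0; apply: measurable_funS => //; exact: subT. Qed.

Let in_horizon t s : 0 <= t -> s \in `[t, T] -> 0 <= s <= T.
Proof. by move=> t0; rewrite in_itv/= => /andP[ts ->]; rewrite (le_trans t0). Qed.

Lemma drift_integrable t p1 p2 : 0 <= t -> admissible_reinsurance T p1 p2 ->
  lebesgue_measure.-integrable `[t, T] (EFin \o drift p1 p2).
Proof.
move=> t0 [mp1 mp2 p01]; case: adm1 => m1 pos1 [M1 b1]; case: adm2 => m2 pos2 [M2 b2].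
apply: (bounded_integrable _ _ _ (`|c - mu| + M1 * sigma ^+ 2 + M2 * sigma ^+ 2)).
  by apply: measurable_on => //; apply: measurable_funB; [apply: measurable_funB => //|];
    apply: measurable_funM; [exact: measurable_funM|exact: measurable_funX|
      exact: measurable_funM|exact: measurable_funX].
move=> s /in_horizon - /(_ t0) sT; have [/andP[? ?] /andP[? ?] _] := p01 s sT.
have h (th M p : R) : 0 < th -> th <= M -> 0 <= p -> p <= 1 ->
    `|th * sigma ^+ 2 * p ^+ 2| <= M * sigma ^+ 2.
  move=> th0 thM q0 q1.
  rewrite ger0_norm; last by rewrite mulr_ge0 ?sqr_ge0// mulr_ge0 ?sqr_ge0// ltW.
  rewrite -[leRHS]mulr1; apply: ler_pM.
  - by rewrite mulr_ge0 ?sqr_ge0// ltW.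
  - exact: sqr_ge0.
  - by rewrite ler_wpM2r ?sqr_ge0.
  - by rewrite expr_le1.
rewrite /drift (le_trans (ler_normB _ _))// lerD//; last by rewrite h ?pos2 ?b2.
by rewrite (le_trans (ler_normB _ _))// lerD// h ?pos1 ?b1.
Qed.

Lemma retention_bounded t p1 p2 : 0 <= t -> admissible_reinsurance T p1 p2 ->
  measurable_fun `[t, T] (retention p1 p2) /\
  (forall s, s \in `[t, T] -> 0 <= retention p1 p2 s <= 1).
Proof.
move=> t0 [mp1 mp2 p01]; split.
  by apply: measurable_on => //; apply: measurable_funB => //; exact: measurable_funB.
move=> s /in_horizon - /(_ t0) sT; have [/andP[? ?] /andP[? ?] /andP[? ?]] := p01 s sT.
by rewrite /retention; apply/andP; split; lra.
Qed.

Lemma sqr_retention_integrable t p1 p2 : 0 <= t -> admissible_reinsurance T p1 p2 ->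
  lebesgue_measure.-integrable `[t, T] (EFin \o (fun s => retention p1 p2 s ^+ 2)).
Proof.
move=> t0 adm; have [mr r01] := retention_bounded t p1 p2 t0 adm.
by apply: (bounded_sqr_integrable _ _ _ 1) => // s /r01 /andP[? ?]; rewrite ger0_norm.
Qed.

Lemma running_cost_integrable t p1 p2 : 0 <= t -> admissible_reinsurance T p1 p2 ->
  lebesgue_measure.-integrable `[t, T] (EFin \o running_cost p1 p2).
Proof.
move=> t0 adm.
apply: (integrable_addr _ (measurableTypeR R) R lebesgue_measure _ (measurable_itv _)
  (fun s => - delta0 * drift p1 p2 s)
  (fun s => (delta0 * sigma) ^+ 2 / 2 * retention p1 p2 s ^+ 2)) => //.
  by apply: integrable_scaler => //; exact: drift_integrable.
by apply: integrable_scaler => //; exact: sqr_retention_integrable.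
Qed.

Lemma expected_utility t x p1 p2 Y : 0 <= t -> admissible_reinsurance T p1 p2 ->
  wiener_integral P W t T (retention p1 p2) Y ->
  (\int[P]_w (U0 delta0 (terminal_surplus T c mu sigma theta1 theta2 t x p1 p2 Y w))%:E
   = (- delta0^-1 * expR (- delta0 * x
       + Rintegral lebesgue_measure `[t, T] (running_cost p1 p2)))%:E)%E.
Proof.
move=> t0 adm wY.
have [mr r01] := retention_bounded t p1 p2 t0 adm.
have r1 s : s \in `[t, T] -> `|retention p1 p2 s| <= 1.
  by move=> /r01 /andP[? ?]; rewrite ger0_norm.
have mgf := wiener_integral_mgf P W BM t T 1 (delta0 * sigma) _ Y t0 mr r1 wY.
pose I := Rintegral lebesgue_measure `[t, T] (drift p1 p2).
pose K := delta0^-1 * expR (- delta0 * (x + I)).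
have K0 : 0 <= K by rewrite mulr_ge0 ?expR_ge0// invr_ge0 ltW.
have mY : measurable_fun setT Y by case: wY.
(* The deterministic factors are collected in [K], and the sign is kept outside so that the
   remaining integrand is nonnegative. *)
transitivity (\int[P]_w - (K%:E * (expR (delta0 * sigma * Y w))%:E))%E.
  apply: eq_integral => w _; rewrite -EFinM -EFinN; congr EFin.
  rewrite /U0 /terminal_surplus -/(drift p1 p2) -/I /K mulNr -(mulrA delta0^-1) -expRD.
  by congr (- (_ * expR _)); ring.
rewrite integral_ge0N; last first.
  by move=> w _; rewrite -EFinM lee_fin mulr_ge0 ?expR_ge0.
rewrite ge0_integralZl_EFin//; last first.
  by apply/measurable_EFinP; apply: measurableT_comp => //; exact: measurable_funM.
rewrite mgf -EFinM -EFinN; congr EFin; rewrite /K [RHS]mulNr -(mulrA delta0^-1) -expRD.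
congr (- (_ * expR _)).
rewrite /running_cost RintegralD//; last 2 first.
- by apply: integrable_scaler => //; exact: drift_integrable.
- by apply: integrable_scaler => //; exact: sqr_retention_integrable.
rewrite RintegralZl//; last exact: sqr_retention_integrable.
rewrite RintegralZl//; last exact: drift_integrable.
by rewrite -/I; ring.
Qed.

End control.

Theorem theorem3p1 (R : realType) (d : measure_display) (Omega : measurableType d)
  (P : probability Omega R) (W : R -> Omega -> R)
  (T c mu sigma delta0 : R) (theta1 theta2 : R -> R) :
  is_brownian_motion P W ->
  0 < T -> 0 < c -> 0 < mu -> 0 < sigma -> 0 < delta0 ->
  admissible_premium T theta1 -> admissible_premium T theta2 ->
  let D := fun s => delta0 * theta1 s + delta0 * theta2 s
                    + 2 * theta1 s * theta2 s in
  let pbar1 := fun s => delta0 * theta2 s / D s in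
  let pbar2 := fun s => delta0 * theta1 s / D s in
  let f0 := fun t => delta0 * Rintegral lebesgue_measure `[t, T]
              (fun s => mu - c + delta0 * sigma ^+ 2 * theta1 s * theta2 s / D s) in
  admissible_reinsurance T pbar1 pbar2 /\
  (forall t x : R, 0 <= t <= T ->
     value_function P W T c mu sigma delta0 theta1 theta2 t x
       = (- delta0^-1 * expR (- delta0 * x + f0 t))%:E /\
     gain_set P W T c mu sigma delta0 theta1 theta2 t x pbar1 pbar2
       (value_function P W T c mu sigma delta0 theta1 theta2 t x)).
Proof.
move=> BM T0 c0 mu0 sigma0 delta00 adm1 adm2 D pbar1 pbar2 f0.
have [m1 pos1 _] := adm1; have [m2 pos2 _] := adm2.
have D0 s : 0 <= s <= T -> 0 < D s.
  move=> sT; have h1 := pos1 s sT; have h2 := pos2 s sT.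
  by rewrite /D !addr_gt0// !mulr_gt0.
have mD : measurable_fun `[0, T] D.
  apply: measurable_funD; last by apply: measurable_funM => //; exact: measurable_funM.
  by apply: measurable_funD; exact: measurable_funM.
have mV : measurable_fun `[0, T] (fun s => (D s)^-1).
  by apply: measurable_inv_pos => // s; rewrite /= in_itv/=; exact: D0.
have adm : admissible_reinsurance T pbar1 pbar2.
  split; [by apply: measurable_funM => //; exact: measurable_funM|
    by apply: measurable_funM => //; exact: measurable_funM|].
  move=> s sT; have h1 := pos1 s sT; have h2 := pos2 s sT; have Ds := D0 s sT.
  have a1 : 0 < delta0 * theta1 s by rewrite mulr_gt0.
  have a2 : 0 < delta0 * theta2 s by rewrite mulr_gt0.
  have a3 : 0 < theta1 s * theta2 s by rewrite mulr_gt0.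
  have le1 u : 0 <= u -> u <= D s -> 0 <= u / D s <= 1.
    by move=> u0 uD; rewrite divr_ge0 ?(ltW Ds)//= ler_pdivrMr// mul1r.
  have DE : D s = delta0 * theta1 s + delta0 * theta2 s + 2 * (theta1 s * theta2 s).
    by rewrite mulrA.
  by split; rewrite /pbar1 /pbar2 -?mulrDl; apply: le1; rewrite ?DE; lra.
split=> // t x /andP[t0 tT].
pose cost p1 p2 s := - delta0 * (c - mu - theta1 s * sigma ^+ 2 * p1 s ^+ 2
    - theta2 s * sigma ^+ 2 * p2 s ^+ 2)
  + (delta0 * sigma) ^+ 2 / 2 * (1 - p1 s - p2 s) ^+ 2.
have sT s : s \in (`[t, T]%classic : set R) -> 0 <= s <= T.
  by move=> /set_mem/=; rewrite in_itv/= => /andP[ts ->]; rewrite (le_trans t0).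
have costE s : s \in (`[t, T]%classic : set R) -> cost pbar1 pbar2 s =
    delta0 * (mu - c + delta0 * sigma ^+ 2 * theta1 s * theta2 s / D s).
  move=> /sT/D0 Ds; rewrite /cost /pbar1 /pbar2.
  by move: Ds; rewrite /D => Ds; field; rewrite gt_eqF.
have f0E : f0 t = Rintegral lebesgue_measure `[t, T] (cost pbar1 pbar2).
  (* The integrand of [f0] inherits integrability from the running cost of the optimum, being
     [delta0^-1] times it. *)
  have wint : lebesgue_measure.-integrable `[t, T] (EFin \o
      (fun s => mu - c + delta0 * sigma ^+ 2 * theta1 s * theta2 s / D s)).
    apply: (@eq_integrable _ (measurableTypeR R) R lebesgue_measure _ (measurable_itv _)
      (EFin \o (fun s => delta0^-1 * cost pbar1 pbar2 s))) => //.
      by move=> s /costE /= ->; rewrite mulKf// gt_eqF.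
    apply: integrable_scaler => //.
    exact: (running_cost_integrable T c mu sigma delta0).
  rewrite /f0 -RintegralZl//; apply: eq_Rintegral => s sD; exact/esym/costE.
have utility p1 p2 Y : admissible_reinsurance T p1 p2 ->
    wiener_integral P W t T (fun s => 1 - p1 s - p2 s) Y ->
    (\int[P]_w (U0 delta0 (terminal_surplus T c mu sigma theta1 theta2 t x p1 p2 Y w))%:E
     = (- delta0^-1 * expR (- delta0 * x
         + Rintegral lebesgue_measure `[t, T] (cost p1 p2)))%:E)%E.
  by move=> admp wY; apply: (expected_utility P W T c mu sigma delta0).
have [mq q01] := retention_bounded T t pbar1 pbar2 t0 adm.
have [Y wY] := wiener_integral_exists t T tT P W BM t0 _ mq q01.
have gain : gain_set P W T c mu sigma delta0 theta1 theta2 t x pbar1 pbar2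
    (- delta0^-1 * expR (- delta0 * x + f0 t))%:E.
  by exists Y => //; rewrite f0E utility.
have valueE : value_function P W T c mu sigma delta0 theta1 theta2 t x
    = (- delta0^-1 * expR (- delta0 * x + f0 t))%:E.
  apply/eqP; rewrite eq_le; apply/andP; split; last first.
    by apply: ereal_sup_ubound; exists pbar1, pbar2.
  apply: ge_ereal_sup => _ [p1 [p2 [admp [Z wZ <-]]]].
  (* The factor [- delta0^-1] is negative, so a larger utility means a smaller integrated cost. *)
  rewrite (utility p1 p2)// lee_fin !mulNr lerN2 ler_pM2l ?invr_gt0// ler_expR lerD2l f0E.
  apply: le_Rintegral => //.
  - exact: (running_cost_integrable T c mu sigma delta0).
  - exact: (running_cost_integrable T c mu sigma delta0).
  move=> s /mem_set sD; have s0T := sT s sD.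
  have := retention_cost_ge _ _ _ _ (p1 s) (p2 s) delta00 (pos1 s s0T) (pos2 s s0T).
  rewrite -/(cost pbar1 pbar2 s) -/(cost p1 p2 s) costE// -/(D s).
  move=> /(ler_wpM2l (_ : 0 <= delta0 * sigma ^+ 2)) h.
  (* Both costs are [delta0 * (mu - c)] plus [delta0 * sigma ^+ 2] times a side of
     [retention_cost_ge]. *)
  have -> : delta0 * (mu - c + delta0 * sigma ^+ 2 * theta1 s * theta2 s / D s)
      = delta0 * (mu - c) + delta0 * sigma ^+ 2 * (delta0 * theta1 s * theta2 s / D s).
    by ring.
  have -> : cost p1 p2 s = delta0 * (mu - c) + delta0 * sigma ^+ 2 *
      (theta1 s * p1 s ^+ 2 + theta2 s * p2 s ^+ 2 + delta0 / 2 * (1 - p1 s - p2 s) ^+ 2).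
    by rewrite /cost; field.
  by rewrite lerD2l h// mulr_ge0 ?sqr_ge0// ltW.
by split=> //; rewrite valueE.
Qed.
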